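(* Let $K$ be an algebraically closed field of characteristic zero, let $\mathcal D(X)$ be the ring of differential operators on a smooth irreducible affine algebraic curve $X$ over $K$, and let $\Gamma(X)$ be its quotient division ring. Then $\mathcal D(X)$ and $\Gamma(X)$ satisfy the commutative centralizer condition.
   Context: The coordinate algebra $\mathcal O=\mathcal O(X)$ is a finitely generated regular domain of Krull dimension $1$. $\mathcal D(X)=\mathcal D(\mathcal O)=\bigcup_{i\ge0}\mathcal D(\mathcal O)_i\subseteq\operatorname{End}_K(\mathcal O)$, where $\mathcal D(\mathcal O)_0=\{u\in\operatorname{End}_K(\mathcal O):ur-ru=0\text{ for all }r\in\mathcal O\}=\operatorname{End}_{\mathcal O}(\mathcal O)\simeq\mathcal O$ and $\mathcal D(\mathcal O)_i=\{u\in\operatorname{End}_K(\mathcal O):ur-ru\in\mathcal D(\mathcal O)_{i-1}\text{ for all }r\in\mathcal O\}$. $\mathcal D(X)$ is a Noetherian domain, and $\Gamma(X)$ is its (left and right) division ring of fractions. A noncommutative algebra satisfies the commutative centralizer condition if the centralizer of each of its non-central elements is a commutative algebra. *)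

(* Defs.v *)
From HB Require Import structures.
From mathcomp Require Import all_boot all_order all_algebra.
From mathcomp Require Import boolp.

Set Implicit Arguments.
Unset Strict Implicit.
Unset Printing Implicit Defensive.

Import GRing.Theory.
Local Open Scope ring_scope.

Section CommutativeAlgebra.

Implicit Type R : comNzRingType.

(* Unlike [idealr_closed], this allows the unit ideal. *)
Definition is_ideal R (I : {pred R}) : Prop :=
  0 \in I /\ forall a, {in I &, forall u v, a * u + v \in I}.

Definition is_prime_ideal R (P : {pred R}) : Prop :=
  idealr_closed P /\ prime_idealr_closed P.

Definition is_maximal_ideal R (M : {pred R}) : Prop :=
  idealr_closed M /\
  forall N : {pred R}, idealr_closed N -> {subset M <= N} -> N =i M.

Definition ideal_generated_by R (s : seq R) (I : {pred R}) : Prop :=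
  forall x, x \in I <->
    exists c : 'I_(size s) -> R, x = \sum_(i < size s) c i * s`_i.

Definition min_generators R (I : {pred R}) (d : nat) : Prop :=
  (exists2 s, size s = d & ideal_generated_by s I) /\
  forall s, ideal_generated_by s I -> (d <= size s)%N.

Definition noetherian R : Prop :=
  forall I : {pred R}, is_ideal I -> exists s, ideal_generated_by s I.

(* A strictly increasing chain P 0 < P 1 < ... < P n; the values of P beyond n
   are irrelevant. *)
Definition prime_chain R (n : nat) (P : nat -> {pred R}) : Prop :=
  (forall i, (i <= n)%N -> is_prime_ideal (P i)) /\
  (forall i, (i < n)%N ->
     {subset P i <= P i.+1} /\ exists2 x, x \in P i.+1 & x \notin P i).

Definition has_krull_dim R (d : nat) : Prop :=
  (exists P, @prime_chain R d P) /\
  (forall n P, @prime_chain R n P -> (n <= d)%N).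

Definition regular_local R : Prop :=
  noetherian R /\
  exists M : {pred R},
    [/\ is_maximal_ideal M,
        forall N : {pred R}, is_maximal_ideal N -> N =i M
      & exists2 d, has_krull_dim R d & min_generators M d].

(* The ring L, with the structure map f, is the localization of R at the
   complement of P; this determines (L, f) up to a unique isomorphism. *)
Definition is_localization_at R (P : {pred R}) (L : comNzRingType)
    (f : {rmorphism R -> L}) : Prop :=
  [/\ forall s, s \notin P -> exists t, f s * t = 1,
      forall y, exists r s, s \notin P /\ y * f s = f r
    & forall r, f r = 0 -> exists2 s, s \notin P & s * r = 0].

Definition regular R : Prop :=
  noetherian R /\
  forall P : {pred R}, is_prime_ideal P ->
    exists (L : comNzRingType) (f : {rmorphism R -> L}),
      is_localization_at P f /\ regular_local L.

End CommutativeAlgebra.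

Definition fin_gen_algebra (K : comNzRingType) (O : comAlgType K) : Prop :=
  exists s : seq O, forall S : {pred O},
    GRing.subalg_closed S -> {subset s <= S} -> forall x, x \in S.

Section DifferentialOperators.

Variables (K : comNzRingType) (O : comAlgType K).

(* The commutator u r - r u in End_K(O), r acting by multiplication. *)
Definition dcomm (u : O -> O) (r : O) : O -> O := fun x => u (r * x) - r * u x.

Fixpoint diffop_order (i : nat) (u : O -> O) : Prop :=
  match i with
  | 0 => forall r x, dcomm u r x = 0
  | i'.+1 => forall r, diffop_order i' (dcomm u r)
  end.

Definition is_diffop (u : O -> O) : Prop :=
  linear u /\ exists i, diffop_order i u.

Record diffop : Type := DiffOp {
  diffop_fun :> O -> O;
  diffopP : is_diffop diffop_fun
}.

Lemma diffop_ext (u v : diffop) : (forall x, u x = v x) -> u = v.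
Proof.
case: u v => [u Pu] [v Pv] /= uv.
have {uv} e : u = v by apply/funext.
by case: _ / e in Pv *; congr DiffOp; exact: Prop_irrelevance.
Qed.

Lemma diffop_linear (u : diffop) : linear u.
Proof. by case: (diffopP u). Qed.

Lemma diffopD (u : diffop) x y : u (x + y) = u x + u y.
Proof. by have := diffop_linear u 1 x y; rewrite !scale1r. Qed.

Lemma diffop0 (u : diffop) : u 0 = 0.
Proof. by apply: (@addrI _ (u 0)); rewrite -diffopD !addr0. Qed.

Lemma diffopZ (u : diffop) a x : u (a *: x) = a *: u x.
Proof. by have := diffop_linear u a x 0; rewrite diffop0 !addr0. Qed.

Lemma diffop_order_ext i u v : u =1 v -> diffop_order i u -> diffop_order i v.
Proof. by move=> /funext ->. Qed.

Lemma linear_lmul (r : O) : linear (fun x => r * x).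
Proof. by move=> a x y; rewrite mulrDr scalerAr. Qed.

Lemma linear_dcomm u r : linear u -> linear (dcomm u r).
Proof.
move=> lu a x y; rewrite /dcomm linear_lmul !lu linear_lmul opprD scalerBr.
by rewrite addrACA.
Qed.

Lemma diffop_orderC i a u v :
  diffop_order i u -> diffop_order i v ->
  diffop_order i (fun x => a *: u x + v x).
Proof.
elim: i u v => [|i IH] u v /= Hu Hv r; last first.
  apply: diffop_order_ext (IH _ _ (Hu r) (Hv r)) => x.
  by rewrite /dcomm mulrDr opprD addrACA scalerBr scalerAr.
move=> x; have := Hu r x; have := Hv r x; rewrite /dcomm => hv hu.
by rewrite mulrDr opprD addrACA -scalerAr -scalerBr hu hv scaler0 addr0.
Qed.

Lemma diffop_order0 i : diffop_order i (fun=> 0).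
Proof.
elim: i => [|i IH] r; first by move=> x; rewrite /dcomm mulr0 subr0.
by apply: diffop_order_ext IH => x; rewrite /dcomm mulr0 subr0.
Qed.

Lemma diffop_orderS i u : diffop_order i u -> diffop_order i.+1 u.
Proof.
elim: i u => [|i IH] u Hu r; last by apply: IH; exact: Hu.
by apply: diffop_order_ext (diffop_order0 0) => x; rewrite Hu.
Qed.

Lemma diffop_orderW i j u :
  (i <= j)%N -> diffop_order i u -> diffop_order j u.
Proof.
move=> /subnK <-; elim: (j - i)%N => // n IH /IH; exact: diffop_orderS.
Qed.

Lemma diffop_orderM i j u v : linear u -> linear v ->
  diffop_order i u -> diffop_order j v -> diffop_order (i + j) (u \o v).
Proof.
move en: (i + j)%N => n; elim: n i j u v en => [|n IH] i j u v en lu lv Hu Hv.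
  case: i j en Hu Hv => [|i] [|j] //= _ Hu Hv r x.
  have := Hu r (v x); have /eqP := Hv r x; rewrite /dcomm /= subr_eq0.
  by move=> /eqP ->.
move=> r.
have E : (fun x => 1 *: (u \o dcomm v r) x + (dcomm u r \o v) x)
         =1 dcomm (u \o v) r.
  move=> x; rewrite /dcomm /= scale1r.
  have uB a b : u (a - b) = u a - u b.
    by rewrite [a - b]addrC -scaleN1r lu scaleN1r [RHS]addrC.
  by rewrite uB addrA subrK.
have dz w : diffop_order 0 w -> dcomm w r = fun=> 0.
  by move=> H; apply/funext => x; exact: H.
have u0 : u 0 = 0.
  by have := lu (-1) 0 0; rewrite scaleN1r oppr0 addr0 scaleN1r addNr.
apply: diffop_order_ext E _; apply: diffop_orderC.
- case: j en Hv => [|j] en Hv.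
    rewrite (dz _ Hv); apply: diffop_order_ext (diffop_order0 n) => x /=.
    by rewrite u0.
  apply: (IH i j _ _ _ lu (linear_dcomm r lv) Hu (Hv r)).
  by move: en; rewrite addnS => -[].
- case: i en Hu => [|i] en Hu.
    by rewrite (dz _ Hu); apply: diffop_order_ext (diffop_order0 n).
  apply: (IH i j _ _ _ (linear_dcomm r lu) lv (Hu r) Hv).
  by move: en; rewrite addSn => -[].
Qed.

Lemma is_diffopC a u v :
  is_diffop u -> is_diffop v -> is_diffop (fun x => a *: u x + v x).
Proof.
move=> [lu [i Hi]] [lv [j Hj]]; split.
  move=> b x y; rewrite lu lv !scalerDr !scalerA [a * b]mulrC.
  by rewrite addrACA.
exists (i + j)%N; apply: diffop_orderC.
  by apply: diffop_orderW Hi; rewrite leq_addr.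
by apply: diffop_orderW Hj; rewrite leq_addl.
Qed.

Lemma is_diffop0 : is_diffop (fun=> 0).
Proof.
split; first by move=> a x y; rewrite scaler0 addr0.
by exists 0%N; exact: diffop_order0.
Qed.

Lemma is_diffopD (u v : diffop) : is_diffop (fun x => u x + v x).
Proof.
have := is_diffopC 1 (diffopP u) (diffopP v).
by under eq_fun do rewrite scale1r.
Qed.

Lemma is_diffopZ a (u : diffop) : is_diffop (fun x => a *: u x).
Proof.
have := is_diffopC a (diffopP u) is_diffop0.
by under eq_fun do rewrite addr0.
Qed.

Lemma is_diffopN (u : diffop) : is_diffop (fun x => - u x).
Proof.
have := is_diffopZ (-1) u.
by under eq_fun do rewrite scaleN1r.
Qed.

Lemma is_diffop1 : is_diffop id.
Proof.
by split=> //; exists 0%N => r x; rewrite /dcomm subrr.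
Qed.

Lemma is_diffopM (u v : diffop) : is_diffop (u \o v).
Proof.
case: u v => [u [lu [i Hi]]] [v [lv [j Hj]]]; split=> /=.
  by move=> a x y /=; rewrite lv lu.
by exists (i + j)%N; exact: diffop_orderM.
Qed.

Definition diffop_zero := DiffOp is_diffop0.
Definition diffop_opp u := DiffOp (is_diffopN u).
Definition diffop_add u v := DiffOp (is_diffopD u v).
Definition diffop_one := DiffOp is_diffop1.
Definition diffop_mul u v := DiffOp (is_diffopM u v).
Definition diffop_scale a u := DiffOp (is_diffopZ a u).

HB.instance Definition _ := gen_eqMixin diffop.
HB.instance Definition _ := gen_choiceMixin diffop.

Lemma diffop_addA : associative diffop_add.
Proof. by move=> u v w; apply: diffop_ext => x /=; rewrite addrA. Qed.
Lemma diffop_addC : commutative diffop_add.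
Proof. by move=> u v; apply: diffop_ext => x /=; rewrite addrC. Qed.
Lemma diffop_add0 : left_id diffop_zero diffop_add.
Proof. by move=> u; apply: diffop_ext => x /=; rewrite add0r. Qed.
Lemma diffop_addN : left_inverse diffop_zero diffop_opp diffop_add.
Proof. by move=> u; apply: diffop_ext => x /=; rewrite addNr. Qed.

HB.instance Definition _ := GRing.isZmodule.Build diffop
  diffop_addA diffop_addC diffop_add0 diffop_addN.

Lemma diffop_mulA : associative diffop_mul.
Proof. by move=> u v w; apply: diffop_ext. Qed.
Lemma diffop_mul1 : left_id diffop_one diffop_mul.
Proof. by move=> u; apply: diffop_ext. Qed.
Lemma diffop_mulr1 : right_id diffop_one diffop_mul.
Proof. by move=> u; apply: diffop_ext. Qed.
Lemma diffop_mulDl : left_distributive diffop_mul +%R.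
Proof. by move=> u v w; apply: diffop_ext. Qed.
Lemma diffop_mulDr : right_distributive diffop_mul +%R.
Proof. by move=> u v w; apply: diffop_ext => x /=; rewrite diffopD. Qed.
Lemma diffop_one_neq0 : diffop_one != 0.
Proof.
apply/eqP => /(congr1 (fun u : diffop => u 1)) /= /eqP.
by rewrite oner_eq0.
Qed.

HB.instance Definition _ := GRing.Zmodule_isNzRing.Build diffop
  diffop_mulA diffop_mul1 diffop_mulr1 diffop_mulDl diffop_mulDr
  diffop_one_neq0.

Lemma diffop_scaleA a b u :
  diffop_scale a (diffop_scale b u) = diffop_scale (a * b) u.
Proof. by apply: diffop_ext => x /=; rewrite scalerA. Qed.
Lemma diffop_scale1 : left_id 1 diffop_scale.
Proof. by move=> u; apply: diffop_ext => x /=; rewrite scale1r. Qed.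
Lemma diffop_scaleDr : right_distributive diffop_scale +%R.
Proof. by move=> a u v; apply: diffop_ext => x /=; rewrite scalerDr. Qed.
Lemma diffop_scaleDl u : {morph diffop_scale^~ u : a b / a + b}.
Proof. by move=> a b; apply: diffop_ext => x /=; rewrite scalerDl. Qed.

HB.instance Definition _ := GRing.Zmodule_isLmodule.Build K diffop
  diffop_scaleA diffop_scale1 diffop_scaleDr diffop_scaleDl.

Lemma diffop_scaleAl a (u v : diffop) : a *: (u * v) = (a *: u) * v.
Proof. by apply: diffop_ext. Qed.

HB.instance Definition _ :=
  GRing.Lmodule_isLalgebra.Build K diffop diffop_scaleAl.

Lemma diffop_scaleAr a (u v : diffop) : a *: (u * v) = u * (a *: v).
Proof. by apply: diffop_ext => x; rewrite [RHS]diffopZ. Qed.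

HB.instance Definition _ :=
  GRing.Lalgebra_isAlgebra.Build K diffop diffop_scaleAr.

End DifferentialOperators.

(* (G, j) is the left and right division ring of fractions of A; it is
   determined by A up to a unique isomorphism. *)
Definition is_division_ring_of_fractions (K : comNzRingType) (A : algType K)
    (G : unitAlgType K) (j : {lrmorphism A -> G}) : Prop :=
  [/\ GRing.field_axiom G,
      injective j,
      forall q, exists a s, s != 0 /\ q = (j s)^-1 * j a
    & forall q, exists a s, s != 0 /\ q = j a * (j s)^-1].

Definition commutative_centralizer_condition (K : comNzRingType)
    (A : algType K) : Prop :=
  ~ commutative (@GRing.mul A) /\
  forall a : A, ~ (forall b, GRing.comm a b) ->
    forall x y : A, GRing.comm a x -> GRing.comm a y -> GRing.comm x y.

(* Main.v *)
Require Import Defs.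
From HB Require Import structures.
From mathcomp Require Import all_boot all_order all_algebra.
From mathcomp Require Import ring boolp classical_sets.
Set Implicit Arguments.
Unset Strict Implicit.
Unset Printing Implicit Defensive.
Import Order.TTheory GRing.Theory Num.Theory.
Local Open Scope ring_scope.

(** Let F be the fraction field of O, and fix a nonscalar x in O. The proof
    controls commutation through the order and the leading coefficient, in F,
    of the elements of D(X) and of its division ring of fractions.

    Since O is a finitely generated domain of Krull dimension one, F is
    algebraic over K(x): by Zariski's lemma [zariski_lemma], a function
    independent of x would give rise to a chain of three primes
    ([transcendence_degree_le1]). Hence a K-derivation of O into F is
    determined by its value at x, and the constants of a nonzero one are the
    scalars ([constants_of_derivation]). On the other hand d/dx extends to F,
    and clearing denominators yields a nonzero derivation of O
    ([exists_derivation]); so D(X) is not commutative.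

    A differential operator commuting with x is a multiplication
    ([commuting_with_coordinate]). So u has order at most m exactly when m + 1
    brackets with x kill it, and then m brackets leave m! times its coefficient
    in order m. Coefficients are multiplicative, commutators lose one order,
    and the bracket with x turns the coefficient f in order m into m f in order
    m - 1. These rules are collected in [is_symbol]; they hold in D(X)
    ([diffop_symP]) and pass to the division ring, where a s^-1 receives the
    difference of the orders and the quotient of the coefficients
    ([frac_symP]).

    Let P have order n <> 0. The bracket with P acts on coefficients of order 0
    as a derivation, which is nonzero because it takes x to n times the
    coefficient of P. If Q1 and Q2 commute with P and have the same order, this
    derivation kills the quotient of their coefficients, which is therefore a
    scalar ([commuting_symbols_proportional]). So, up to a scalar and to terms
    of lower order, the order determines the elements of the centralizer of P.
    If n > 0, choose Q in the centralizer whose order generates, together with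
    n, the group of all orders occurring there: then each S in the centralizer
    agrees, after multiplication by a power of P, with a polynomial in P and Q
    up to terms of arbitrarily low order ([centralizer_approximation]).
    Commutators in the centralizer thus have arbitrarily low order, and vanish.
    Multiplying by powers of P, rather than dividing by powers of Q, lets the
    same argument serve D(X) and its division ring.

    For n < 0, which happens only in the division ring, P is replaced by its
    inverse. For n = 0, either the coefficient of P is a scalar c and P is
    replaced by P - c, or everything that commutes with P has order 0; then
    commutators have negative order and commute with P, so they vanish. *)

(** * Subrings and fractions *)

Definition is_subring (L : nzRingType) (S : L -> Prop) : Prop :=
  [/\ S 1, forall a b, S a -> S b -> S (a - b)
    & forall a b, S a -> S b -> S (a * b)].

Section SubringTheory.
Variables (L : nzRingType) (S : L -> Prop).
Hypothesis subS : is_subring S.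

Lemma subring0 : S 0.
Proof. by case: subS => S1 SB _; rewrite -(subrr 1); exact: SB. Qed.

Lemma subringN a : S a -> S (- a).
Proof. by case: subS => _ SB _ Sa; rewrite -sub0r; apply: SB => //;
  exact: subring0. Qed.

Lemma subringD a b : S a -> S b -> S (a + b).
Proof. by case: subS => _ SB _ Sa Sb; rewrite -[b]opprK; apply/SB/subringN. Qed.

Lemma subring_sum I (r : seq I) (P : pred I) (F : I -> L) :
  (forall i, P i -> S (F i)) -> S (\sum_(i <- r | P i) F i).
Proof. by move=> SF; apply: (big_ind S) => //;
  [exact: subring0 | exact: subringD]. Qed.

Lemma subringX a n : S a -> S (a ^+ n).
Proof.
case: subS => S1 _ SM Sa; elim: n => [|n IH]; first by rewrite expr0.
by rewrite exprS; exact: SM.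
Qed.

End SubringTheory.

Section Fraction.
Variable R : idomainType.
Local Notation "x %:F" := (FracField.tofrac x).

Lemma fractionP (x : {fraction R}) : exists a b, b != 0 /\ x = a%:F / b%:F.
Proof.
exists (\n_(repr x)), (\d_(repr x)); split; first exact: denom_ratioP.
have d0 : (\d_(repr x))%:F != 0 by rewrite tofrac_eq0 denom_ratioP.
apply: (mulIf d0); rewrite divfK //.
move: (repr x) (reprK x) => r <-; rewrite -[LHS]/(FracField.mul _ _) !piE.
apply/eqP; rewrite FracField.equivf_def.
rewrite /FracField.mulf !numden_Ratio ?oner_neq0 ?mulf_neq0 ?denom_ratioP //.
- by rewrite !mulr1 mulrC.
- exact: oner_neq0.
- exact: oner_neq0.
Qed.

Lemma frac_lift (L : fieldType) (f : {rmorphism R -> L}) : injective f ->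
  exists g : {rmorphism {fraction R} -> L}, forall a, g a%:F = f a.
Proof.
move=> f_inj.
have fn0 x : x != 0 -> f x != 0.
  by apply: contra_neq => fx; apply: f_inj; rewrite fx rmorph0.
have [g gE] : exists g : {fraction R} -> L,
    forall a b, b != 0 -> g (a%:F / b%:F) = f a / f b.
  have ex x : exists y, forall a b, b != 0 -> x = a%:F / b%:F -> y = f a / f b.
    have [a [b [b0 ->]]] := fractionP x; exists (f a / f b) => c d d0 /eqP.
    rewrite eqr_div ?tofrac_eq0 // -!tofracM tofrac_eq => /eqP e.
    by apply/eqP; rewrite eqr_div ?fn0 // -!rmorphM e.
  exists (fun x => projT1 (cid (ex x))) => a b b0.
  by case: cid => y /= /(_ a b b0); apply.
have g_tofrac a : g a%:F = f a.
  have := gE a 1; rewrite tofrac1 divr1 rmorph1 divr1; apply.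
  exact: oner_neq0.
have gB : zmod_morphism g.
  move=> x y; have [a [b [b0 ->]]] := fractionP x.
  have [c [d [d0 ->]]] := fractionP y.
  rewrite -mulNr addf_div ?tofrac_eq0 // -tofracN -!tofracM -tofracD.
  rewrite !gE ?mulf_neq0 // !rmorphM rmorphD !rmorphM rmorphN.
  by rewrite -[- (_ / _)]mulNr addf_div ?fn0.
have gM : monoid_morphism g.
  split; first by rewrite -tofrac1 g_tofrac rmorph1.
  move=> x y; have [a [b [b0 ->]]] := fractionP x.
  have [c [d [d0 ->]]] := fractionP y.
  by rewrite mulf_div -!tofracM !gE ?mulf_neq0 // mulf_div -!rmorphM.
pose gA := GRing.isZmodMorphism.Build _ _ g gB.
pose gMu := GRing.isMonoidMorphism.Build _ _ g gM.
pose G : {rmorphism {fraction R} -> L} := HB.pack g gA gMu.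
by exists G.
Qed.

(** Denominators are cleared one coefficient at a time. *)
Lemma algebraicOver_frac (L : fieldType) (f : {rmorphism R -> L})
    (g : {rmorphism {fraction R} -> L}) z :
  (forall a, g a%:F = f a) -> algebraicOver g z ->
  exists2 p : {poly R}, p != 0 & root (map_poly f p) z.
Proof.
move=> gE [p p0 pz].
have [d [q [d0 Dq]]] : exists d (q : {poly R}),
    d != 0 /\ map_poly (@FracField.tofrac R) q = d%:F *: p.
  elim/poly_ind: p {p0 pz} => [|p c [d [q [d0 Dq]]]].
    by exists 1, 0; rewrite oner_neq0 scaler0 rmorph0.
  have [a [b [b0 ->]]] := fractionP c.
  exists (d * b), (b *: q * 'X + (d * a)%:P); rewrite mulf_neq0 //; split=> //.
  rewrite rmorphD rmorphM /= map_polyZ map_polyX map_polyC Dq scalerDr /=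
    !tofracM.
  rewrite scalerAl !scalerA [_ * d%:F]mulrC; congr (_ + _).
  by rewrite -mul_polyC -polyCM mulrACA divff ?tofrac_eq0 ?mulr1.
exists q.
  apply: contra_neq p0 => q0; move/eqP: Dq.
  by rewrite q0 rmorph0 eq_sym scaler_eq0 tofrac_eq0 (negPf d0) => /eqP.
have -> : map_poly f q = map_poly g (map_poly (@FracField.tofrac R) q).
  by rewrite -map_poly_comp; apply: eq_map_poly => x /=.
by rewrite Dq map_polyZ rootE hornerZ (rootP pz) mulr0.
Qed.

End Fraction.

(** * Algebraic elements and Zariski's lemma *)

(** It is the image of [p] that has to be nonzero: this keeps the notion
    meaningful when [f] is not injective. *)
Definition alg_over (R L : nzRingType) (f : R -> L) (z : L) : Prop :=
  exists2 p : {poly R}, map_poly f p != 0 & root (map_poly f p) z.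

Definition adjoin (R : comNzRingType) (L : comNzRingType)
  (f : {rmorphism R -> L})
  (t : L) : {rmorphism {poly R} -> L} := horner_eval t \o map_poly f.
Arguments adjoin : simpl never.

Lemma adjoinE (R L : comNzRingType) (f : {rmorphism R -> L}) t p :
  adjoin f t p = (map_poly f p).[t].
Proof. by []. Qed.

Lemma adjoinC (R L : comNzRingType) (f : {rmorphism R -> L}) t c :
  adjoin f t c%:P = f c.
Proof. by rewrite adjoinE map_polyC hornerC. Qed.

Lemma adjoinX (R L : comNzRingType) (f : {rmorphism R -> L}) t :
  adjoin f t 'X = t.
Proof. by rewrite adjoinE map_polyX hornerX. Qed.

Lemma rmorph_inj0 (R L : nzRingType) (f : {rmorphism R -> L}) :
  (forall x, f x = 0 -> x = 0) -> injective f.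
Proof. by move=> f0 x y e; apply/eqP; rewrite -subr_eq0; apply/eqP/f0;
  rewrite rmorphB e subrr. Qed.

Lemma rmorph_inj_neq0 (R L : nzRingType) (f : {rmorphism R -> L}) x :
  injective f -> x != 0 -> f x != 0.
Proof. by move=> f_inj; apply: contra_neq => fx; apply: f_inj;
  rewrite fx rmorph0. Qed.

Lemma adjoin_inj (R : idomainType) (L : fieldType) (f : {rmorphism R -> L}) t :
  injective f -> ~ alg_over f t -> injective (adjoin f t).
Proof.
move=> f_inj tr; apply: rmorph_inj0 => p pt0; apply/eqP/negP => /negP p0.
by apply: tr; exists p; [rewrite map_poly_eq0_id0 // rmorph_inj_neq0 //
  lead_coef_eq0|exact/rootP].
Qed.

Lemma alg_over_comp (R R' L : nzRingType) (h : {rmorphism R -> R'})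
    (f : {rmorphism R -> L}) (f' : {rmorphism R' -> L}) z :
  (forall c, f' (h c) = f c) -> alg_over f z -> alg_over f' z.
Proof.
move=> fE [p p0 pz]; have e : map_poly f' (map_poly h p) = map_poly f p.
  by rewrite -map_poly_comp; apply: eq_map_poly => c /=.
by exists (map_poly h p); rewrite e.
Qed.

Lemma alg_over_adjoin (R L : comNzRingType) (f : {rmorphism R -> L}) t z :
  alg_over f z -> alg_over (adjoin f t) z.
Proof. by apply: (alg_over_comp (h := polyC)) => c; exact: adjoinC. Qed.

Lemma alg_over_id (R L : nzRingType) (f : {rmorphism R -> L}) c :
  alg_over f (f c).
Proof.
exists ('X - c%:P); rewrite rmorphB /= map_polyX map_polyC ?polyXsubC_eq0 //.
by rewrite root_XsubC.
Qed.

Lemma alg_over_algebraic (R : idomainType) (L : fieldType)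
    (f : {rmorphism R -> L}) (g : {rmorphism {fraction R} -> L}) z :
  (forall a, g (FracField.tofrac a) = f a) ->
  alg_over f z <-> algebraicOver g z.
Proof.
move=> gE; split=> [/(alg_over_comp (h := @FracField.tofrac R))|].
  by case/(_ _ gE) => p p0 pz; exists p => //; move: p0; rewrite map_poly_eq0.
move=> /(algebraicOver_frac gE) [p p0 pz]; exists p => //.
rewrite map_poly_eq0_id0 // -gE fmorph_eq0 tofrac_eq0 lead_coef_eq0 //.
Qed.

Lemma alg_over_subring (R : idomainType) (L : fieldType)
  (f : {rmorphism R -> L}) :
  injective f -> is_subring (alg_over f).
Proof.
move=> /frac_lift[g gE]; split=> [|a b|a b]; rewrite !(alg_over_algebraic _ gE).
- exact: algebraic1.
- exact: algebraic_sub.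
- exact: algebraic_mul.
Qed.

Section Zariski.
Variable L : fieldType.

(** Adjoin the elements of [s] one by one, ignoring those that are algebraic at
    their turn; [t] is the last one adjoined, and [R'] the ring just below. *)
Lemma transcendental_tower (s : seq L) (R : idomainType)
    (f : {rmorphism R -> L}) (A : L -> Prop) :
  injective f -> is_subring A -> (forall c, A (f c)) -> {in s, forall z, A z} ->
  {in s, forall z, alg_over f z} \/
  exists (R' : idomainType) (f' : {rmorphism R' -> L}) (t : L),
    [/\ injective f', (forall c, exists c', f' c' = f c),
        (forall c', A (f' c')), A t /\ ~ alg_over f' t
      & {in s, forall z, alg_over (adjoin f' t) z}].
Proof.
move=> f_inj subA Af; elim: s => [|z s IH] As; first by left.
have Az : A z by apply: As; rewrite mem_head.
have {}IH := IH (fun y ys => As y (mem_behead (s := z :: s) ys)).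
have step (R' : idomainType) (f' : {rmorphism R' -> L}) :
    injective f' -> (forall c, exists c', f' c' = f c) ->
    (forall c', A (f' c')) -> ~ alg_over f' z ->
    {in s, forall z, alg_over f' z} ->
  exists (R' : idomainType) (f' : {rmorphism R' -> L}) (t : L),
    [/\ injective f', (forall c, exists c', f' c' = f c),
        (forall c', A (f' c')), A t /\ ~ alg_over f' t
      & {in z :: s, forall z, alg_over (adjoin f' t) z}].
  move=> inj' ext' A' nz sa; exists R', f', z; split=> // y.
  rewrite inE => /predU1P[->|/sa]; last exact: alg_over_adjoin.
  by rewrite -{2}(adjoinX f' z); exact: alg_over_id.
case: IH => [sa|[R' [f' [t [inj' ext' A' [At nt] sa]]]]].
  have [za|nza] := pselect (alg_over f z).
    by left=> y; rewrite inE => /predU1P[->|/sa].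
  by right; apply: (step R f) => // c; exists c.
right; have [za|nza] := pselect (alg_over (adjoin f' t) z).
  by exists R', f', t; split=> // y; rewrite inE => /predU1P[->|/sa].
apply: (step {poly R'} (adjoin f' t)) => //.
- exact: adjoin_inj.
- by move=> c; have [c' <-] := ext' c; exists c'%:P; rewrite adjoinC.
- move=> p; rewrite adjoinE horner_coef.
  have [_ _ AM] := subA; apply: subring_sum => // i _; apply: AM.
    by rewrite coef_map; exact: A'.
  exact: subringX.
Qed.

(** Inverting [d] makes every element of [s] integral. *)
Lemma common_denominator (R : idomainType) (f : {rmorphism R -> L})
  (s : seq L) :
  injective f -> {in s, forall z, alg_over f z} ->
  exists2 d, d != 0 & {in s, forall z, exists (p : {poly R}) c,
    root (map_poly f p) z /\ lead_coef p * c = d}.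
Proof.
move=> f_inj; elim: s => [|z s IH] sa; first by exists 1; rewrite ?oner_neq0.
have [d d0 dP] := IH (fun y ys => sa y (mem_behead (s := z :: s) ys)).
have [p p0 pz] := sa z (mem_head _ _).
exists (lead_coef p * d).
  rewrite mulf_neq0 // lead_coef_eq0; apply: contra_neq p0 => ->.
  by rewrite rmorph0.
move=> y; rewrite inE => /predU1P[->|/dP[q [c [qy <-]]]]; first by exists p, d.
by exists q, (lead_coef p * c); rewrite mulrCA.
Qed.

(** The hypotheses say that A is finitely generated over R and becomes a field
    once the nonzero elements of R are inverted. If A were not algebraic, it
    would be integral over R'[t][1/d] for some ring R' between R and A, some t
    transcendental over R' and some nonzero d in R'[t]. The element g = d t + 1
    divides a nonzero element b of R in A; clearing the denominators in an
    integral equation of b / g shows that g divides a multiple of some power of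
    b by a power of d, hence that power of b since g is prime to d. But g has
    positive degree in t. *)
Lemma zariski_lemma (s : seq L) (R : idomainType) (f : {rmorphism R -> L})
    (A : L -> Prop) :
  injective f -> is_subring A -> (forall c, A (f c)) -> {in s, forall z, A z} ->
  (forall S, is_subring S -> (forall c, S (f c)) -> {in s, forall z, S z} ->
     forall z, A z -> S z) ->
  (forall a, A a -> a != 0 -> exists a' c, [/\ A a', c != 0 & a * a' = f c]) ->
  forall z, A z -> alg_over f z.
Proof.
move=> f_inj subA Af As genA divA.
have [sa|] := transcendental_tower f_inj subA Af As.
  by apply: genA => // [|c]; [exact: alg_over_subring | exact: alg_over_id].
move=> [R' [f' [t [inj' ext' A' [At nt] sa]]]]; exfalso.
pose e := adjoin f' t; have e_inj : injective e by exact: adjoin_inj.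
have [d d0 dP] := common_denominator e_inj sa.
have ed0 : e d != 0 by exact: rmorph_inj_neq0.
pose ev := adjoin e (e d)^-1.
have evE q c : ev (q * c *: 'X) = e q * e c / e d.
  by rewrite /ev -mul_polyC rmorphM adjoinC adjoinX rmorphM.
have subI : is_subring (integralOver ev).
  by split=> [|a b|a b]; [exact: integral1|exact: integral_sub|exact:
    integral_mul].
have AI z : A z -> integralOver ev z.
  apply: genA => // [c|{}z /dP[p [c [pz pc]]]].
    have [c' <-] := ext' c.
    by rewrite -(adjoinC f' t) -/e -(adjoinC e (e d)^-1); exact: integral_id.
  have c0 : e c != 0.
    by apply: rmorph_inj_neq0 => //; apply: contra_neq d0 => c0;
      rewrite -pc c0 mulr0.
  have l0 : e (lead_coef p) != 0.
    by apply: rmorph_inj_neq0 => //; apply: contra_neq d0 => l0;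
      rewrite -pc l0 mul0r.
  pose q := (e c / e d) *: map_poly e p.
  have qm : q \is monic.
    rewrite monicE lead_coefZ lead_coef_map_inj ?rmorph0 // mulrAC.
    by rewrite -rmorphM [c * _]mulrC pc divff.
  apply: (@integral_root_monic _ _ _ z q) => //.
    by rewrite rootE hornerZ (rootP pz) mulr0.
  apply/integral_poly => i; rewrite coefZ coef_map mulrC mulrA -evE.
  exact: integral_id.
have Ae p : A (e p).
  rewrite /e adjoinE horner_coef.
  have [_ _ AM] := subA; apply: subring_sum => // i _; apply: AM.
    by rewrite coef_map; exact: A'.
  exact: subringX.
pose g := d * 'X + 1.
have sg : size g = (size d).+1.
  by rewrite /g -polyC1 size_MXaddC (negPf d0).
have g0 : g != 0 by rewrite -size_poly_gt0 sg.
have [a [b [Aa b0 Db]]] := divA _ (Ae g) (rmorph_inj_neq0 e_inj g0).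
have [b' Db'] := ext' b.
pose B u := exists M r, u * e d ^+ M = e r.
have subB : is_subring B.
  split=> [|u v [M [r Dr]] [N [q Dq]]|u v [M [r Dr]] [N [q Dq]]].
  - by exists 0, 1; rewrite rmorph1 mulr1.
  - exists (M + N)%N, (r * d ^+ N - q * d ^+ M).
    rewrite rmorphB !rmorphM !rmorphXn -Dr -Dq exprD mulrBl.
    by rewrite -!mulrA [e d ^+ N * _]mulrC.
  - exists (M + N)%N, (r * q).
    by rewrite rmorphM -Dr -Dq exprD mulrACA.
have Be p : B (e p) by exists 0, p; rewrite mulr1.
have Bev q : B (ev q).
  rewrite /ev adjoinE horner_coef.
  have [_ _ BM] := subB; apply: subring_sum => // i _; apply: BM.
    by rewrite coef_map; exact: Be.
  apply: subringX => //; exists 1, 1.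
  by rewrite mulVf // rmorph1.
have [p pm pa] := AI _ Aa.
(* The integral equation of [a = b / g], multiplied by [g ^ n]. *)
have [n Dn] : exists n, size p = n.+1.
  by exists (size p).-1; rewrite prednK // size_poly_gt0 monic_neq0.
have [M [r Dr]] : exists M r, e d ^+ M * e b'%:P ^+ n = e g * e r.
  have evp : size (map_poly ev p) = n.+1.
    by rewrite size_map_poly_id0 // (monicP pm) rmorph1 oner_neq0.
  have evi i : (map_poly ev p)`_i = ev p`_i by rewrite coef_map.
  have Ba : e g * a = e b'%:P by rewrite Db -Db' /e adjoinC.
  have : exists2 u, B u & e b'%:P ^+ n = e g * u.
    have pn : p`_n = 1 by have := monicP pm; rewrite /lead_coef Dn.
    have -> : e b'%:P ^+ n = e g ^+ n * a ^+ n by rewrite -Ba exprMn.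
    have -> : a ^+ n = - \sum_(i < n) ev p`_i * a ^+ i.
      apply/eqP; rewrite -addr_eq0 addrC; apply/eqP; apply: etrans (rootP pa).
      rewrite horner_coef evp big_ord_recr; congr (_ + _); last first.
        by rewrite evi [nat_of_ord ord_max]/= pn rmorph1 mul1r.
      by apply: eq_bigr => i _; rewrite evi.
    exists (- \sum_(i < n) ev p`_i * e b'%:P ^+ i * e g ^+ (n - i.+1)).
      have [_ _ BM] := subB.
      apply: subringN => //; apply: subring_sum => // i _.
      by apply: (BM); [apply: BM => //|]; exact: subringX.
    rewrite !mulrN !mulr_sumr; congr (- _).
    apply: eq_bigr => i _; rewrite -Ba exprMn.
    have -> : e g ^+ n = e g ^+ i * e g * e g ^+ (n - i.+1).
      by rewrite -exprSr -exprD subnKC.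
    ring.
  by case=> u [M [r Dr]] ->; exists M, r; rewrite -Dr; ring.
have {}Dr : d ^+ M * b'%:P ^+ n = g * r.
  by apply: e_inj; rewrite !(rmorphM, rmorphXn) /=; exact: Dr.
(* Modulo [g], the product ['X * d] is -1: this removes the power of [d]. *)
have [q Dq] : exists q, ('X * d) ^+ M = (-1) ^+ M + g * q.
  elim: M {Dr} => [|M [q Dq]]; first by exists 0; rewrite mulr0 addr0.
  exists ((-1) ^+ M + 'X * d * q); rewrite exprS Dq exprS /g; ring.
pose c : {poly R'} := b'%:P ^+ n.
have {Dr} Dc : c = g * ((-1) ^+ M * ('X ^+ M * r - q * c)).
  have -> : g * ((-1) ^+ M * ('X ^+ M * r - q * c)) =
      (-1) ^+ M * ('X ^+ M * (g * r) - (g * q) * c) by ring.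
  rewrite -Dr; have -> : g * q = ('X * d) ^+ M - (-1) ^+ M
    by rewrite Dq addrAC subrr add0r.
  rewrite -/c exprMn; have e1 : (-1) ^+ M * (-1) ^+ M = 1 :> {poly R'}.
    by rewrite -exprMn mulrNN mulr1 expr1n.
  by transitivity ((-1) ^+ M * (-1) ^+ M * c); [rewrite e1 mul1r | ring].
have c0 : c != 0.
  rewrite expf_neq0 // polyC_eq0; apply: contra_neq b0 => b'0.
  by apply: f_inj; rewrite -Db' b'0 !rmorph0.
have sc : (size c <= 1)%N by rewrite /c -rmorphXn size_polyC leq_b1.
have r0 : (-1) ^+ M * ('X ^+ M * r - q * c) != 0.
  by apply: contra_neq c0 => z; rewrite Dc z mulr0.
move: sc; rewrite Dc size_mul // sg; move: r0 d0; rewrite -!size_poly_gt0.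
by case: (size d) => // m; case: (size _) => // l _ _; rewrite addSn addnS.
Qed.
End Zariski.

(** * Derivations into a field of characteristic zero *)
Definition is_derivation (R L : comNzRingType) (f : {rmorphism R -> L})
    (D : {additive R -> L}) : Prop :=
  forall a b, D (a * b) = f a * D b + f b * D a.

(** A pair [(f, D)] for which this holds amounts to a derivation of the subring
    [f(R)] of [L]. Polynomial rings can thus stand for the subrings of [L] onto
    which they map, and no quotient has to be formed. *)
Definition descends (R L : comNzRingType) (f : {rmorphism R -> L})
    (D : {additive R -> L}) : Prop :=
  forall a, f a = 0 -> D a = 0.

Lemma derivation1 (R L : comNzRingType) (f : {rmorphism R -> L})
  (D : {additive R -> L}) :
  is_derivation f D -> D 1 = 0.
Proof.
move=> derD; have := derD 1 1; rewrite rmorph1 !mul1r => e.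
by apply: (@addrI _ (D 1)); rewrite -e addr0.
Qed.

Section Derivations.
Let hornE := (hornerD, hornerN, hornerM, hornerX, hornerC).
Variables (L : fieldType) (charL0 : [pchar L] =i pred0).

(** A relation of minimal degree: the derivative has smaller degree and, in
    characteristic zero, is nonzero, so it does not vanish at [z]. *)
Lemma separable_annihilator (R : comNzRingType) (f : {rmorphism R -> L}) z :
  alg_over f z -> exists q : {poly R},
    [/\ root (map_poly f q) z, (map_poly f q)^`().[z] != 0, f (lead_coef q) != 0
      & forall r : {poly R}, (size r < size q)%N -> root (map_poly f r) z ->
          map_poly f r = 0].
Proof.
move=> az; pose P n := `[< exists q : {poly R},
  [/\ size q = n, map_poly f q != 0 & root (map_poly f q) z] >].
have exP : exists n, P n by case: az => q q0 qz; exists (size q);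
  apply/asboolP; exists q.
have [n /asboolP[q [sq q0 qz]] min_n] := ex_minnP exP.
have min (r : {poly R}) : (size r < size q)%N -> root (map_poly f r) z ->
  map_poly f r = 0.
  rewrite sq ltnNge => lt_r rz; apply/eqP/negP => /negP r0; move/negP: lt_r;
    apply.
  by apply: min_n; apply/asboolP; exists r.
have lq : f (lead_coef q) != 0.
  apply/negP => /eqP lq0; pose r := q - lead_coef q *: 'X^((size q).-1).
  have q_neq0 : q != 0 by apply: contra_neq q0 => ->; rewrite rmorph0.
  have sr : (size r < size q)%N.
    rewrite -[X in (_ < X)%N]prednK ?size_poly_gt0 // ltnS.
    apply/leq_sizeP => j; rewrite leq_eqVlt => /predU1P[<-|lt_j].
      by rewrite coefB coefZ coefXn eqxx mulr1 subrr.
    rewrite coefB coefZ coefXn gtn_eqF // mulr0 subr0 nth_default //.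
    by rewrite -[X in (X <= _)%N]prednK ?size_poly_gt0.
  have er : map_poly f r = map_poly f q.
    by rewrite rmorphB /= map_polyZ lq0 scale0r subr0.
  by move: q0; rewrite -er min ?eqxx // er.
exists q; split=> //; have sfq : size (map_poly f q) = size q
  by exact: size_map_poly_id0.
apply/negP => /eqP dz; have : map_poly f q^`() = 0.
  apply: min; last by rewrite -deriv_map; apply/rootP.
  apply: lt_size_deriv; apply: contra_neq q0 => ->; exact: rmorph0.
have [m sm] : exists m, size q = m.+2.
  have : (1 < size q)%N by rewrite -sfq; exact: root_size_gt1 qz.
  by case: (size q) => [|[|m]] // _; exists m.
move/(congr1 (fun p : {poly L} => p`_m)); rewrite coef0 coef_map coef_deriv =>
  /eqP.
rewrite /= rmorphMn -mulr_natr mulf_eq0 (pcharf0P L).1 // orbF.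
by move: lq; rewrite /lead_coef sm => /negPf ->.
Qed.

Lemma derivation_horner (D : {additive L -> L}) (p : {poly L}) z :
  is_derivation idfun D ->
  D p.[z] = (map_poly D p).[z] + p^`().[z] * D z.
Proof.
move=> derD; elim/poly_ind: p => [|p c IH].
  by rewrite deriv0 !horner0 mul0r addr0 !raddf0 horner0.
rewrite !hornE raddfD /= derD IH derivD derivM derivX derivC !hornE /=.
have -> : map_poly D (p * 'X + c%:P) = map_poly D p * 'X + (D c)%:P.
  apply/polyP => i; rewrite coef_map !coefD !coefMX !coefC raddfD /= coef_map
    /=.
  by congr (_ + _); case: eqP => //; rewrite raddf0.
rewrite !hornE; ring.
Qed.

(** Differentiating a separable relation q(z) = 0 gives q'(z) D z = 0. *)
Lemma derivation_alg_over_constants (R : comNzRingType) (f : {rmorphism R -> L})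
    (D : {additive L -> L}) z :
  is_derivation idfun D -> (forall c, D (f c) = 0) -> alg_over f z -> D z = 0.
Proof.
move=> derD Df0 /separable_annihilator[q [/rootP qz dq _ _]].
have := derivation_horner (map_poly f q) z derD; rewrite qz raddf0.
have -> : map_poly D (map_poly f q) = 0.
  by apply/polyP => i; rewrite !coef_map Df0 coef0.
by rewrite horner0 add0r => /eqP; rewrite eq_sym mulf_eq0 (negPf dq) => /eqP.
Qed.

(** The value of the extension at [z] is dictated by differentiating the
    minimal relation q(z) = 0. To see that it descends, divide a relation p by
    q: some multiple of p by a power of the leading coefficient of q is u q + r,
    and by minimality the coefficients of r vanish in [L]. *)
Lemma derivation_adjoin (R : comNzRingType) (f : {rmorphism R -> L})
    (D : {additive R -> L}) z :
  is_derivation f D -> descends f D -> alg_over f z ->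
  exists D' : {additive {poly R} -> L},
    [/\ is_derivation (adjoin f z) D', descends (adjoin f z) D'
      & forall c, D' c%:P = D c].
Proof.
move=> derD desD /separable_annihilator[q [qz dq lq min_q]].
pose T p := (map_poly D p).[z].
have [d Eq0] : exists d, T q + (map_poly f q)^`().[z] * d = 0.
  by exists (- T q / (map_poly f q)^`().[z]); rewrite mulrC divfK // addrN.
pose D' p := T p + (map_poly f p)^`().[z] * d.
have D'B : zmod_morphism D'.
  by move=> p r; rewrite /D' /T raddfB rmorphB /= derivB !hornE; ring.
pose D'A := GRing.isZmodMorphism.Build _ _ D' D'B.
pose E : {additive {poly R} -> L} := HB.pack D' D'A.
have EE p : E p = (map_poly D p).[z] + (map_poly f p)^`().[z] * d by [].
have EC c : E c%:P = D c.
  by rewrite !EE !map_polyC derivC !hornE mul0r addr0.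
have EMX p : E (p * 'X) = E p * z + adjoin f z p * d.
  rewrite !EE adjoinE; have -> : map_poly D (p * 'X) = map_poly D p * 'X.
    by apply/polyP => i; rewrite coef_map !coefMX coef_map; case: eqP;
      rewrite // raddf0.
  by rewrite rmorphM /= map_polyX derivM derivX !hornE; ring.
have ECM c p : E (c%:P * p) = f c * E p + adjoin f z p * D c.
  rewrite !EE adjoinE rmorphM /= map_polyC derivM derivC mul0r add0r.
  have -> : map_poly D (c%:P * p) = (f c)%:P * map_poly D p + (D c)%:P *
    map_poly f p.
    apply/polyP => i; rewrite coef_map coefCM coefD !coefCM !coef_map /= derD.
    by rewrite [f p`_i * _]mulrC.
  by rewrite !hornE; ring.
have derE : is_derivation (adjoin f z) E.
  move=> p r; elim/poly_ind: p => [|p c IH].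
    by rewrite mul0r raddf0 rmorph0 mul0r mulr0 addr0.
  have -> : (p * 'X + c%:P) * r = p * r * 'X + c%:P * r by ring.
  rewrite raddfD EMX IH ECM [E (p * 'X + _)]raddfD EMX EC rmorphD !rmorphM
    adjoinC adjoinX; ring.
have E0 r : map_poly f r = 0 -> E r = 0.
  move=> r0; rewrite !EE r0 derivC horner0 mul0r addr0.
  suff -> : map_poly D r = 0 by rewrite horner0.
  by apply/polyP => i; rewrite coef_map coef0 desD // -(coef_map f) r0 coef0.
exists E; split=> // p pz.
have := Pdiv.ComRing.rdivp_eq q p.
set u := Pdiv.Ring.rdivp p q; set r := Pdiv.Ring.rmodp p q;
  set c := _ ^+ _ => Dp.
have q0 : q != 0 by apply: contraNneq lq => ->; rewrite lead_coef0 rmorph0.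
have qz' : adjoin f z q = 0 by exact/rootP.
have rz : map_poly f r = 0.
  apply: min_q; first by rewrite Pdiv.Ring.ltn_rmodp.
  apply/rootP; rewrite -adjoinE.
  have -> : r = c *: p - u * q by rewrite Dp addrAC subrr add0r.
  by rewrite rmorphB -mul_polyC !rmorphM pz qz' !mulr0 subrr.
have fc : f c != 0 by rewrite rmorphXn expf_neq0.
have : E (c *: p) = 0 by rewrite Dp raddfD (E0 r rz) derE (EE q) -/(T q) Eq0
  qz' mul0r mulr0 !addr0.
by rewrite -mul_polyC ECM pz mul0r addr0 => /eqP;
  rewrite mulf_eq0 (negPf fc) => /eqP.
Qed.

Lemma derivation_tower (s : seq L) (R : comNzRingType) (f : {rmorphism R -> L})
    (D : {additive R -> L}) :
  is_derivation f D -> descends f D -> {in s, forall z, alg_over f z} ->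
  exists (R' : comNzRingType) (f' : {rmorphism R' -> L})
    (D' : {additive R' -> L}),
    [/\ is_derivation f' D', descends f' D',
        forall c, exists c', f' c' = f c /\ D' c' = D c
      & {in s, forall z, exists c', f' c' = z}].
Proof.
elim: s R f D => [|z s IH] R f D derD desD sa.
  by exists R, f, D; split=> // c; exists c.
have [D1 [der1 des1 ext1]] := derivation_adjoin derD desD (sa z (mem_head _ _)).
have sa1 : {in s, forall y, alg_over (adjoin f z) y}.
  by move=> y ys; apply: alg_over_adjoin; apply: sa; rewrite inE ys orbT.
have [R' [f' [D' [der' des' ext' sE]]]] := IH _ _ _ der1 des1 sa1.
exists R', f', D'; split=> // [c|y].
  by have [c' [fc' Dc']] := ext' c%:P; exists c'; rewrite fc' Dc' adjoinC ext1.
rewrite inE => /predU1P[->|]; last exact: sE.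
by have [c' [fc' _]] := ext' 'X; exists c'; rewrite fc' adjoinX.
Qed.

Lemma derivation_descend (R O : comNzRingType) (f : {rmorphism R -> L})
    (D : {additive R -> L}) (phi : {rmorphism O -> L}) :
  is_derivation f D -> descends f D -> (forall x, exists c, f c = phi x) ->
  exists2 E : {additive O -> L}, is_derivation phi E
    & forall x c, f c = phi x -> E x = D c.
Proof.
move=> derD desD /choice[r fr].
have DrE x c : f c = phi x -> D (r x) = D c.
  move=> fc; apply/eqP; rewrite -subr_eq0 -raddfB; apply/eqP/desD.
  by rewrite rmorphB fr fc subrr.
have EB : zmod_morphism (D \o r).
  by move=> x y /=; rewrite -raddfB; apply: DrE; rewrite !rmorphB !fr.
pose EA := GRing.isZmodMorphism.Build _ _ (D \o r) EB.
pose E : {additive O -> L} := HB.pack (D \o r) EA.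
exists E; last exact: DrE.
move=> x y; rewrite -!fr -derD; apply: DrE; by rewrite !rmorphM !fr.
Qed.

(** The quotient rule. *)
Lemma derivation_frac (O : comNzRingType) (phi : {rmorphism O -> L})
    (D : {additive O -> L}) :
  (forall z, exists a b, phi b != 0 /\ z = phi a / phi b) ->
  is_derivation phi D -> descends phi D ->
  exists2 E : {additive L -> L}, is_derivation idfun E & forall x,
    E (phi x) = D x.
Proof.
move=> fracL derD desD.
have {fracL} /choice[num /choice[den fr]] := fracL.
pose E z := (phi (den z) * D (num z) - phi (num z) * D (den z)) / phi (den z)
  ^+ 2.
have Ew a b z : phi b != 0 -> z = phi a / phi b ->
    E z = (phi b * D a - phi a * D b) / phi b ^+ 2.
  move=> b0 Dz; have [d0 Dz'] := fr z.
  have e : phi (num z) * phi b = phi a * phi (den z).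
    by apply/eqP; rewrite -eqr_div // -Dz' -Dz.
  have : D (num z * b) = D (a * den z).
    apply/eqP; rewrite -subr_eq0 -raddfB; apply/eqP/desD.
    by rewrite rmorphB !rmorphM e subrr.
  rewrite /E !derD; move: (D (num z)) (D b) (D a) (D (den z)) => Dn Db Da Dd eD.
  apply/eqP; rewrite eqr_div ?expf_neq0 //; apply/eqP.
  move: e eD d0 b0; move: (phi (num z)) (phi (den z)) (phi a)
    (phi b) => n d x y e eD d0 y0.
  have Dn' : y * Dn = x * Dd + d * Da - n * Db
    by rewrite -eD addrAC subrr add0r.
  have -> : (d * Dn - n * Dd) * y ^+ 2 = d * y * (y * Dn) - (n * y) * y * Dd
    by ring.
  rewrite Dn' e.
  have -> : d * y * (x * Dd + d * Da - n * Db) - x * d * y * Dd = d ^+ 2 * y *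
    Da - d * (n * y) * Db by ring.
  rewrite e; ring.
have EB : zmod_morphism E.
  move=> x y; have [dx0 Dx] := fr x; have [dy0 Dy] := fr y.
  rewrite (Ew (num x * den y - num y * den x) (den x * den y)).
  - rewrite /E raddfB /= !derD rmorphB !rmorphM.
    move: dx0 dy0 {Dx Dy}; move: (phi (den x)) (phi (den y)) (phi (num x))
      (phi (num y)) => p q n m p0 q0.
    move: (D (den x)) (D (den y)) (D (num x)) (D (num y)) => Dp Dq Dn Dm.
    by field; rewrite p0 q0.
  - by rewrite rmorphM mulf_neq0.
  - by rewrite rmorphB !rmorphM [in LHS]Dx [in LHS]Dy; field; rewrite dx0 dy0.
pose EA := GRing.isZmodMorphism.Build _ _ E EB.
exists (HB.pack E EA : {additive L -> L}) => [x y|x] /=.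
  have [dx0 Dx] := fr x; have [dy0 Dy] := fr y.
  rewrite (Ew (num x * num y) (den x * den y)).
  - have -> : x * E y + y * E x =
        phi (num x) / phi (den x) * E y + phi (num y) / phi (den y) * E x.
      by rewrite -Dx -Dy.
    rewrite /E !derD !rmorphM.
    move: dx0 dy0 {Dx Dy}; move: (phi (den x)) (phi (den y)) (phi (num x))
      (phi (num y)) => p q n m p0 q0.
    move: (D (den x)) (D (den y)) (D (num x)) (D (num y)) => Dp Dq Dn Dm.
    by field; rewrite p0 q0.
  - by rewrite rmorphM mulf_neq0.
  - by rewrite !rmorphM [in LHS]Dx [in LHS]Dy; field; rewrite dx0 dy0.
rewrite (Ew x 1) ?rmorph1 ?oner_neq0 ?divr1 //.
by rewrite (derivation1 derD) expr1n divr1 mulr0 subr0 mul1r.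
Qed.
End Derivations.

(** * Prime ideals and fields attached to a commutative ring *)

Section CommutativeRings.

(** Inverses are chosen classically, so that the domain acquires the unit
    structure over which fractions are built. *)
Lemma fraction_field (R : comNzRingType) : GRing.integral_domain_axiom R ->
  exists (L : fieldType) (phi : {rmorphism R -> L}),
    injective phi /\ forall z, exists a b, phi b != 0 /\ z = phi a / phi b.
Proof.
move=> domR.
pose isU (x : R) := `[< exists y, y * x = 1 >].
pose inv (x : R) := if pselect (exists y, y * x = 1) is left e then projT1 (cid
  e) else x.
have mulVx : {in isU, left_inverse 1 inv *%R}.
  move=> x /asboolP xU; rewrite /inv; case: pselect => // e.
  by case: cid.
have unitPl x y : y * x = 1 -> isU x by move=> e; apply/asboolP; exists y.
have inv_out : {in [predC isU], inv =1 id}.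
  move=> x; rewrite inE => /asboolP xU; rewrite /inv; by case: pselect.
pose U : comUnitRingType :=
  HB.pack (GRing.ComNzRing.sort R) (GRing.ComNzRing_hasMulInverse.Build R mulVx
    unitPl inv_out).
pose D : idomainType :=
  HB.pack (GRing.ComNzRing.sort R) (GRing.ComUnitRing.class U)
    (GRing.ComUnitRing_isIntegral.Build U domR).
pose phi : {rmorphism D -> {fraction D}} := @FracField.tofrac D.
exists {fraction D}, phi; split.
  by apply: rmorph_inj0 => x /eqP; rewrite tofrac_eq0 => /eqP.
move=> z; have [a [b [b0 ->]]] := fractionP z; exists a, b.
by rewrite tofrac_eq0.
Qed.

Lemma residue_field (R : comNzRingType) (P : {pred R}) : is_prime_ideal P ->
  exists (L : fieldType) (phi : {rmorphism R -> L}), forall x,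
    (phi x == 0) = (x \in P).
Proof.
move=> [idP prP].
pose I : prime_idealr R := HB.pack (P : R -> bool) (isIdealr.Build R P idP)
   (isPrimeIdealrClosed.Build R P prP).
have domQ : GRing.integral_domain_axiom {ideal_quot I}.
  exact: Quotient.rquot_IdomainAxiom.
have [L [phi [phi_inj _]]] := fraction_field domQ.
exists L, (phi \o \pi_{ideal_quot I}%qT) => x /=.
have -> : (phi (\pi_{ideal_quot I}%qT x) == 0) = (\pi_{ideal_quot I}%qT x == 0).
  by apply/eqP/eqP => [e|->]; [apply: phi_inj;
    rewrite e rmorph0|rewrite rmorph0].
by rewrite -(rmorph0 (\pi_{ideal_quot I}%qT)) -Quotient.idealrBE subr0.
Qed.

Local Open Scope classical_set_scope.

(** An ideal that is maximal among those avoiding a multiplicative set is prime: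
    if neither u nor v belongs to it, then it meets the set after adjoining
    either of them, and so does it after adjoining u v. *)
Lemma prime_avoiding (R : comNzRingType) (I : {pred R}) (T : R -> Prop) :
  is_ideal I -> T 1 -> (forall x y, T x -> T y -> T (x * y)) ->
  (forall x, x \in I -> ~ T x) ->
  exists P : {pred R}, [/\ is_prime_ideal P, {subset I <= P}
    & forall x, x \in P -> ~ T x].
Proof.
move=> [I0 IM] T1 TM IT.
pose good (J : set R) := [/\ forall a u v, J u -> J v -> J (a * u + v),
  forall x, x \in I -> J x & forall x, J x -> ~ T x].
have goodI : good [set x | x \in I].
  by split=> //= a u v; exact: IM.
have [A [AP Amax]] : exists A : set R, (A = set0 \/ good A) /\
    forall B, A `<` B -> ~ (B = set0 \/ good B).
  apply: (@Zorn_bigcup R (fun J => J = set0 \/ good J)) => F FP Ftot.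
  have [F0|] := pselect (forall J, F J -> J = set0).
    left; rewrite predeqE => x; split=> // -[J FJ Jx].
    by rewrite (F0 J FJ) in Jx.
  move=> /existsNP[J0 /not_implyP[FJ0 J0n]]; right.
  have gJ J x : F J -> J x -> good J.
    by move=> FJ Jx; case: (FP J FJ) => // Je; rewrite Je in Jx.
  split=> [a u v [J FJ Ju] [J' FJ' Jv]|x xI|x [J FJ Jx]].
  - have [sJ|sJ] := Ftot J J' FJ FJ'.
      exists J' => //; have [+ _ _] := gJ J' v FJ' Jv; apply=> //; exact: sJ.
    exists J => //; have [+ _ _] := gJ J u FJ Ju; apply=> //; exact: sJ.
  - by exists J0 => //; case: (FP J0 FJ0) => // -[_ + _]; exact.
  - by have [_ _ +] := gJ J x FJ Jx; exact.
have {}AP : good A.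
  case: AP => // A0; exfalso; apply: (Amax [set x | x \in I]); last by right.
  by rewrite A0; split=> //= /(_ 0 I0).
have [AM AI AT] := AP; have A0 : A 0 by exact: AI.
have AD u v : A u -> A v -> A (u + v) by rewrite -{2}[u]mul1r; exact: AM.
have AMl a u : A u -> A (a * u) by move=> Au; rewrite -[_ * _]addr0; exact: AM.
have meet u : ~ A u -> exists a r, A a /\ T (a + r * u).
  move=> nAu; pose B := [set y | exists a r, A a /\ y = a + r * u].
  apply: contrapT => nT; apply: (Amax B).
    split=> [y Ay|/(_ u) sB]; first by exists y, 0; rewrite mul0r addr0.
    by apply: nAu; apply: sB; exists 0, 1; rewrite mul1r add0r.
  right; split=> [a y z [b [r [Ab ->]]] [c [q [Ac ->]]]|y yI|y [a [r [Aa ->]]]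
    Ty].
  - exists (a * b + c), (a * r + q); split; [exact: AM | ring].
  - by exists y, 0; split; [exact: AI | rewrite mul0r addr0].
  - by apply: nT; exists a, r.
pose P : {pred R} := fun x => `[< A x >].
have PP x : reflect (A x) (x \in P) by exact: asboolP.
exists P; split=> [|x xI|x /PP /AT //]; last by apply/PP/AI.
split; first split.
- exact/PP.
- by apply/PP => /AT /(_ T1).
- by move=> a u v /PP Au /PP Av; apply/PP; exact: AM.
- move=> u v /PP Auv.
  have [Au|/meet[a [r [Aa Ta]]]] := pselect (A u); first by apply/orP; left;
    exact/PP.
  have [Av|/meet[b [q [Ab Tb]]]] := pselect (A v); first by apply/orP; right;
    exact/PP.
  case: (AT _ _ (TM _ _ Ta Tb)).
  have -> : (a + r * u) * (b + q * v) = (b + q * v) * a + (r * u * b + r * q *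
    (u * v)) by ring.
  by apply: AM => //; apply: AD; exact: AMl.
Qed.

End CommutativeRings.

(** * The function field of the curve *)

Lemma alg_over_closed (K : closedFieldType) (L : fieldType)
  (f : {rmorphism K -> L}) z :
  alg_over f z -> exists c, z = f c.
Proof.
case=> p p0 /rootP pz; have [r Dp] := closed_field_poly_normal p.
have lp : f (lead_coef p) != 0.
  by rewrite fmorph_eq0 lead_coef_eq0; apply: contra_neq p0 => ->;
    rewrite rmorph0.
have : \prod_(a <- r) (z - f a) = 0.
  apply: (mulfI lp); rewrite mulr0 -pz Dp map_polyZ hornerZ lead_coefZ.
  rewrite (monicP (monic_prod_XsubC _ _ _)) mulr1 rmorph_prod horner_prod;
    congr (_ * _).
  by apply: eq_bigr => a _; rewrite rmorphB /= map_polyX map_polyC hornerXsubC.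
move/eqP; rewrite prodf_seq_eq0 => /hasP[a _ /=].
by rewrite subr_eq0 => /eqP ->; exists a.
Qed.

(** One bivariate relation, read over [u] or over [v]. *)
Lemma adjoin_swap (R L : comNzRingType) (f : {rmorphism R -> L}) u v
    (q : {poly {poly R}}) :
  (map_poly (adjoin f u) q).[v] = (map_poly (adjoin f v) (swapXY q)).[u].
Proof.
have adjE w (p : {poly {poly R}}) :
    map_poly (adjoin f w) p = map_poly (horner_eval w)
      (map_poly (map_poly f) p).
  by rewrite -map_poly_comp; apply: eq_map_poly => x.
rewrite !adjE -swapXY_map -!horner_swapXY swapXYK.
by rewrite -horner2_swapXY swapXYK.
Qed.

Section Curve.
Variables (K : closedFieldType) (charK0 : [pchar K] =i pred0)
  (O : comAlgType K).
Hypotheses (domO : GRing.integral_domain_axiom O) (fgO : fin_gen_algebra O).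
Hypothesis dimO : has_krull_dim O 1%N.

(** A nonzero element of a prime ideal is not a scalar, for nonzero scalars are
    invertible. *)
Lemma exists_nonscalar : exists x : O, forall c, x <> c%:A.
Proof.
have [[P [primeP incP]] _] := dimO.
have [_ [x xP1 xP0]] := incP 0 isT; exists x => c xc.
have [[P00 _ _] _] := primeP 0 isT; have [[P10 P11 P1M] _] := primeP 1 isT.
have [c0|c0] := eqVneq c 0; first by move: xP0; rewrite xc c0 scale0r P00.
move/negP: P11; apply; have := P1M c^-1%:A x 0 xP1 P10.
by rewrite addr0 xc -scalerAl mul1r scalerA mulVf // scale1r.
Qed.

Lemma subalg_rmorph (L : comNzRingType) (phi : {rmorphism O -> L}) (s : seq O)
  (S : L -> Prop) :
  (forall T : {pred O}, GRing.subalg_closed T -> {subset s <= T} -> forall x,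
    x \in T) ->
  is_subring S -> (forall c, S (phi c%:A)) -> {in [seq phi g | g <- s],
    forall z, S z} ->
  forall x, S (phi x).
Proof.
move=> sgen subS Sc Ss x; pose T : {pred O} := fun x => `[< S (phi x) >].
have TP y : reflect (S (phi y)) (y \in T) by exact: asboolP.
have [S1 _ SM] := subS.
apply/TP/sgen => [|y ys]; last by apply/TP/Ss/map_f.
split=> [|c u v /TP Su /TP Sv|u v /TP Su /TP Sv]; apply/TP.
- by rewrite rmorph1.
- rewrite rmorphD -mulr_algl rmorphM; apply: subringD => //; exact: SM.
- by rewrite rmorphM; exact: SM.
Qed.

Variables (L : fieldType) (phi : {rmorphism O -> L}).
Hypothesis phi_inj : injective phi.
Hypothesis fracL : forall z, exists a b, phi b != 0 /\ z = phi a / phi b.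

Let kL : {rmorphism K -> L} := phi \o in_alg O.

Lemma adjoin_scalar_inj (z : L) : (forall c, z <> kL c) -> injective (adjoin kL
  z).
Proof.
move=> nz; apply: adjoin_inj; first exact: fmorph_inj.
by case/alg_over_closed => c; exact: nz.
Qed.

Lemma kL_nonscalar x : (forall c, x <> c%:A) -> forall c, phi x <> kL c.
Proof. by move=> nx c /phi_inj; exact: nx. Qed.

Lemma adjoin_image (x : O) p : exists y, adjoin kL (phi x) p = phi y.
Proof.
exists (map_poly (in_alg O) p).[x].
by rewrite adjoinE map_poly_comp horner_map.
Qed.

(** If some function is transcendental over K(x), then by Zariski's lemma O does
    not become a field when K[x] minus 0 is inverted: some nonzero b has no
    multiple there, and lies in a prime P1 avoiding it. In the quotient by P1
    the image of x is still transcendental over K, so by Zariski's lemma again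
    this quotient is not a field, and P1 is properly contained in a prime P2.
    The chain 0 < P1 < P2 contradicts Krull dimension one. *)
Lemma transcendence_degree_le1 (x : O) (z : L) :
  (forall c, x <> c%:A) -> alg_over (adjoin kL (phi x)) z.
Proof.
move=> nx; have nLx := kL_nonscalar nx; have zi := adjoin_scalar_inj nLx.
suff algO y : alg_over (adjoin kL (phi x)) (phi y).
  have [g gE] := frac_lift zi; have [a [b [_ ->]]] := fracL z.
  apply/(alg_over_algebraic _ gE); apply: algebraic_div;
    exact/(alg_over_algebraic _ gE).
have [s sgen] := fgO.
have [divO|ndivO] := pselect (forall b, b != 0 -> exists b' c, c != 0 /\
    phi b * phi b' = adjoin kL (phi x) c).
  apply: (@zariski_lemma L [seq phi g | g <- s] _ (adjoin kL (phi x))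
    (fun z => exists b, z = phi b)) => //; last by exists y.
  - split=> [|u v [a ->] [b ->]|u v [a ->] [b ->]]; first by exists 1;
      rewrite rmorph1.
      by exists (a - b); rewrite rmorphB.
    by exists (a * b); rewrite rmorphM.
  - exact: adjoin_image.
  - by move=> _ /mapP[g _ ->]; exists g.
  - move=> S subS Sf Ss _ [b ->]; apply: (subalg_rmorph sgen subS) => // c.
    by have := Sf c%:P; rewrite adjoinC.
  - move=> _ [b ->] b0; have [|b' [c [c0 e]]] := divO b.
      by apply: contra_neq b0 => ->; rewrite rmorph0.
    by exists (phi b'), c; split=> //; exists b'.
exfalso; move: ndivO => /existsNP[b /not_implyP[b0 nb]].
pose T (t : O) := exists2 c, c != 0 & phi t = adjoin kL (phi x) c.
pose I1 : {pred O} := fun t => `[< exists r, t = r * b >].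
have I1P t : reflect (exists r, t = r * b) (t \in I1) by exact: asboolP.
have [P1 [prP1 I1P1 TP1]] : exists P : {pred O}, [/\ is_prime_ideal P,
  {subset I1 <= P}
    & forall t, t \in P -> ~ T t].
  apply: prime_avoiding.
  - split=> [|a u v /I1P[r ->] /I1P[q ->]]; apply/I1P; first by exists 0;
      rewrite mul0r.
    by exists (a * r + q); ring.
  - by exists 1; rewrite ?oner_neq0 // !rmorph1.
  - by move=> u v [c c0 e] [d d0 e']; exists (c * d);
      rewrite ?mulf_neq0 // !rmorphM e e'.
  - move=> t /I1P[r ->] [c c0 e]; apply: nb; exists r, c.
    by rewrite -rmorphM mulrC.
have [L1 [psi psiP]] := residue_field prP1.
have [z0 [z0P nz0]] : exists z0, psi z0 != 0 /\
    forall r c, c != 0 -> psi z0 * psi r <> psi c%:A.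
  apply: contrapT => nz.
  have divO a : psi a != 0 -> exists a' c, c != 0 /\ psi a * psi a' = psi c%:A.
    move=> a0; apply: contrapT => na; apply: nz; exists a; split=> // r c c0 e.
    by apply: na; exists r, c.
  have : alg_over (psi \o in_alg O) (psi x).
    apply: (@zariski_lemma L1 [seq psi g | g <- s] _ (psi \o in_alg O)
      (fun z => exists b, z = psi b)); last by exists x.
    - exact: fmorph_inj.
    - split=> [|u v [a ->] [d ->]|u v [a ->] [d ->]]; first by exists 1;
        rewrite rmorph1.
        by exists (a - d); rewrite rmorphB.
      by exists (a * d); rewrite rmorphM.
    - by move=> c; exists c%:A.
    - by move=> _ /mapP[g _ ->]; exists g.
    - by move=> S subS Sf Ss _ [d ->]; apply: (subalg_rmorph sgen subS).
    - move=> _ [a ->] /divO[a' [c [c0 e]]]; exists (psi a'), c; split=> //.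
      by exists a'.
  case/alg_over_closed => c /= e; apply: (TP1 (x - c%:A)).
    by rewrite -psiP rmorphB e subrr.
  exists ('X - c%:P); first by rewrite polyXsubC_eq0.
  by rewrite !rmorphB adjoinX adjoinC.
pose I2 : {pred O} := fun t => `[< exists p r, p \in P1 /\ t = p + r * z0 >].
have I2P t : reflect (exists p r, p \in P1 /\ t = p + r * z0) (t \in I2)
  by exact: asboolP.
have [idP1 _] := prP1; have [P10 P11 P1M] := idP1.
have [P2 [prP2 I2P2 _]] : exists P : {pred O}, [/\ is_prime_ideal P,
  {subset I2 <= P}
    & forall t, t \in P -> ~ (t = 1)].
  apply: prime_avoiding => //.
  - split=> [|a u v /I2P[p [r [pP ->]]] /I2P[p' [r' [p'P ->]]]]; apply/I2P.
      by exists 0, 0; rewrite P10 mul0r addr0.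
    by exists (a * p + p'), (a * r + r'); split; [exact: P1M | ring].
  - by move=> u v -> ->; rewrite mulr1.
  - move=> t /I2P[p [r [pP ->]]] e; apply: (nz0 r 1 (oner_neq0 _)).
    rewrite scale1r -e rmorphD rmorphM mulrC.
    by move: pP; rewrite -psiP => /eqP ->; rewrite add0r.
pose chain i : {pred O} := if i is i'.+1 then if i' is _.+1 then P2 else P1
  else pred1 0.
have [_ dim] := dimO; suff /dim : prime_chain 2 chain by [].
split.
  case=> [|[|[|]]] //= _; split.
    split; rewrite ?inE ?eqxx ?oner_eq0 // => a u v.
    by rewrite !inE => /eqP -> /eqP ->; rewrite mulr0 addr0.
  by move=> u v; rewrite !inE => /eqP; exact: domO.
case=> [|[|]] //= _; split.
- by move=> t; rewrite inE => /eqP ->.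
- by exists b => //; apply: I1P1; apply/I1P; exists 1; rewrite mul1r.
- by move=> t tP1; apply: I2P2; apply/I2P; exists t, 0; rewrite mul0r addr0.
- exists z0; last by rewrite -psiP.
  by apply: I2P2; apply/I2P; exists 0, 1; rewrite mul1r add0r.
Qed.

Lemma charL0 : [pchar L] =i pred0.
Proof. by move=> p; rewrite (fmorph_pchar kL) charK0. Qed.

(** The quotient w = a / b is killed by the extension of [E] to the function
    field. If w is not a scalar, it is transcendental over K, so the function
    field is algebraic over K(w) and [E] would vanish. *)
Lemma constants_of_derivation (E : {additive O -> L}) (a b : O) :
  is_derivation phi E -> (forall c, E c%:A = 0) -> (exists y, E y != 0) ->
  b != 0 -> phi a * E b = phi b * E a -> exists c, a = c%:A * b.
Proof.
move=> derE E0 [y Ey] b0 Eab.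
have desE : descends phi E.
  by move=> u u0; rewrite (@phi_inj u 0) ?raddf0 // u0 rmorph0.
have [F derF FE] := derivation_frac fracL derE desE.
have pb0 : phi b != 0 by exact: rmorph_inj_neq0.
pose w := phi a / phi b.
have Fw : F w = 0.
  apply: (mulfI pb0); rewrite mulr0.
  have : F (w * phi b) = E a by rewrite divfK // FE.
  rewrite derF FE /= => e; apply: (mulfI pb0).
  have -> : phi b * (phi b * F w) = phi b * (w * E b + phi b * F w) - (w * phi
    b) * E b by ring.
  by rewrite e divfK // Eab subrr mulr0.
have [[c wc]|nw] := pselect (exists c, w = kL c).
  exists c; apply: phi_inj; rewrite rmorphM -[phi c%:A]/(kL c) -wc divfK //.
have {}nw c : w <> kL c by move=> wc; apply: nw; exists c.
have ny c : y <> c%:A by move=> yc; rewrite yc E0 eqxx in Ey.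
have [q q0 qw] := transcendence_degree_le1 w ny.
case/negP: Ey; apply/eqP; rewrite -FE.
apply: (@derivation_alg_over_constants L charL0 _ (adjoin kL w) F _ derF).
  elim/poly_ind => [|p c IH]; first by rewrite rmorph0 raddf0.
  rewrite rmorphD rmorphM adjoinX adjoinC raddfD derF /= IH Fw !mulr0 !add0r.
  by rewrite FE E0.
exists (swapXY q); last by rewrite /root -adjoin_swap.
have wi := adjoin_scalar_inj nw.
rewrite map_poly_eq0_id0; last first.
  rewrite rmorph_inj_neq0 // lead_coef_eq0 swapXY_eq0.
  by apply: contra_neq q0 => ->; rewrite rmorph0.
by rewrite swapXY_eq0; apply: contra_neq q0 => ->; rewrite rmorph0.
Qed.

(** The derivation d/dx of K[x] extends through a finite set of generators of
    O, with values in the function field; multiplied by a common denominator h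
    of the derivatives of these generators, it maps O into O. *)
Lemma exists_derivation : exists E : {additive O -> O},
  [/\ is_derivation idfun E, forall c, E c%:A = 0 & exists y, E y != 0].
Proof.
have [x nx] := exists_nonscalar; have zi := adjoin_scalar_inj (kL_nonscalar nx).
have algL z := transcendence_degree_le1 z nx.
move: zi algL; set f := adjoin kL (phi x) => zi algL.
have [s sgen] := fgO.
pose D : {additive {poly K} -> L} := f \o (@deriv K).
have DE p : D p = f p^`() by [].
have derD : is_derivation f D.
  move=> p q; rewrite !DE derivM rmorphD !rmorphM; ring.
have desD : descends f D.
  by move=> p p0; rewrite (zi p 0) ?raddf0 // p0 rmorph0.
have [R' [f' [D' [derD' desD' ext' sE]]]] :=
  derivation_tower charL0 (s := [seq phi g | g <- s]) derD desD (fun z _ =>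
    algL z).
have imf y : exists c, f' c = phi y.
  apply: (subalg_rmorph (S := fun z => exists c, f' c = z) sgen) => //.
    split=> [|u v [a <-] [b <-]|u v [a <-] [b <-]]; first by exists 1;
      rewrite rmorph1.
      by exists (a - b); rewrite rmorphB.
    by exists (a * b); rewrite rmorphM.
  by move=> c; have [c' [fc _]] := ext' c%:P; exists c'; rewrite fc /f adjoinC.
have [E derE EE] := derivation_descend derD' desD' imf.
have Ex : E x = 1.
  have [c [fc Dc]] := ext' 'X; rewrite (EE x c) ?fc /f ?adjoinX //.
  by rewrite Dc DE derivX rmorph1.
have Ec c : E c%:A = 0.
  have [c' [fc Dc]] := ext' c%:P; rewrite (EE _ c') ?fc /f ?adjoinC //.
  by rewrite Dc DE derivC rmorph0.
have [h h0 hE] : exists2 h, h != 0 & {in s, forall g, exists e,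
  phi h * E g = phi e}.
  elim: (s) => [|g s' [h h0 IH]]; first by exists 1; rewrite ?oner_neq0.
  have [a [b [b0 Eg]]] := fracL (E g); exists (h * b).
    apply: contra_neq h0 => hb; apply: phi_inj; apply: (mulIf b0).
    by rewrite -rmorphM hb rmorph0 mul0r.
  move=> g'; rewrite inE => /predU1P[->|/IH[e he]].
    by exists (h * a); rewrite Eg !rmorphM -mulrA [phi b * _]mulrC divfK.
  by exists (e * b); rewrite !rmorphM -he; ring.
have {}hE y : exists e, phi h * E y = phi e.
  pose T : {pred O} := fun y => `[< exists e, phi h * E y = phi e >].
  have TP u : reflect (exists e, phi h * E u = phi e) (u \in T)
    by exact: asboolP.
  apply/TP/sgen => [|g gs]; last by apply/TP/hE.
  split=> [|c u v /TP[a ea] /TP[b eb]|u v /TP[a ea] /TP[b eb]]; apply/TP.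
  - by exists 0; rewrite (derivation1 derE) mulr0 rmorph0.
  - exists (c%:A * a + b); rewrite rmorphD rmorphM -ea -eb -[c *: u]mulr_algl.
    by rewrite raddfD /= derE Ec; ring.
  - by exists (u * b + v * a); rewrite rmorphD !rmorphM -ea -eb derE; ring.
move/choice: hE => [F FE].
have FB : zmod_morphism F.
  by move=> u v; apply: phi_inj; rewrite rmorphB -!FE raddfB mulrBr.
exists (HB.pack F (GRing.isZmodMorphism.Build _ _ F FB) : {additive O -> O});
  split.
- move=> u v /=; apply: phi_inj; rewrite rmorphD !rmorphM -!FE derE; ring.
- by move=> c /=; apply: phi_inj; rewrite -FE Ec mulr0 rmorph0.
- exists x => /=; apply: contra_neq h0 => Fx; apply: phi_inj.
  by have := FE x; rewrite Ex Fx mulr1.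
Qed.

End Curve.

(** * Orders and coefficients: centralizers are commutative *)

Section SymbolMap.
Variables (K : closedFieldType) (O : comAlgType K) (L : fieldType)
  (phi : {rmorphism O -> L}).

(** [sym a n f] is to be read: [a] has order at most [n], and [f] is its
    coefficient in order [n], which is 0 when the order is smaller than [n]. A
    relation accommodates the zero element, which has every order. Condition
    [sym_unit] allows a passage to positive order; among differential operators
    only 0 has negative order, and it holds vacuously. *)
Record is_symbol (A : algType K) (x : O) (h : A)
  (sym : A -> int -> L -> Prop) : Prop := {
  sym0 : forall n, sym 0 n 0;
  sym_uniq : forall a n f g, sym a n f -> sym a n g -> f = g;
  symB : forall a b n f g, sym a n f -> sym b n g -> sym (a - b) n (f - g);
  symM : forall a b n m f g, sym a n f -> sym b m g ->
    sym (a * b) (n + m) (f * g);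
  sym_exact : forall a, a != 0 -> exists n f, f != 0 /\ sym a n f;
  sym_lower : forall a n, sym a n 0 -> exists f, sym a (n - 1) f;
  sym_raise : forall a n f, sym a (n - 1) f -> sym a n 0;
  sym_scalar : forall c, sym c%:A 0 (phi c%:A);
  sym_function : forall y, exists a, sym a 0 (phi y);
  sym_coordinate : sym h 0 (phi x);
  sym_ad : forall a n f, sym a n f -> sym (a * h - h * a) (n - 1) (n%:~R * f);
  sym_unit : forall a n f, sym a n f -> f != 0 -> n < 0 ->
    exists b, a * b = 1 /\ b * a = 1
}.

Hypothesis charL : [pchar L] =i pred0.
Hypothesis fracL : forall z, exists a b, phi b != 0 /\ z = phi a / phi b.
Hypothesis const_der : forall (E : {additive O -> L}) (a b : O),
  is_derivation phi E -> (forall c, E c%:A = 0) -> (exists y, E y != 0) ->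
  b != 0 -> phi a * E b = phi b * E a -> exists c, a = c%:A * b.

Variables (A : algType K) (x : O) (h : A) (sym : A -> int -> L -> Prop).
Hypothesis symP : is_symbol x h sym.

Implicit Types (a b P Q S T U : A) (n m v w d : int) (f g p q : L).

Lemma intr_neq0 n : n != 0 -> n%:~R != 0 :> L.
Proof.
case: n => k n0; last rewrite NegzE mulrNz oppr_eq0.
  by rewrite -pmulrn (pcharf0P L).1.
by rewrite -pmulrn (pcharf0P L).1.
Qed.

Lemma symD a b n f g : sym a n f -> sym b n g -> sym (a + b) n (f + g).
Proof.
move=> sa sb; rewrite -[b]opprK -[g]opprK -[- b]sub0r -[- g]sub0r.
by apply: (symB symP) => //; apply: (symB symP) => //; exact: (sym0 symP).
Qed.

Lemma sym_lt a n m f : sym a n f -> n < m -> sym a m 0.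
Proof.
move=> sa; rewrite -subr_gt0; case Dk: (m - n) => [[|k]|k] // _.
have -> : m = n + k.+1%:Z by rewrite -Dk addrC subrK.
elim: k {m Dk} => [|k IH]; first by apply: (sym_raise symP (f := f));
  rewrite addrK.
by apply: (sym_raise symP (f := 0)); rewrite -addn1 PoszD addrA addrK.
Qed.

Lemma sym_exact_le a n m f g : sym a n f -> f != 0 -> sym a m g -> n <= m.
Proof.
move=> sa f0 sa'; rewrite leNgt; apply/negP => /(sym_lt sa') sa0.
by move/negP: f0; apply; apply/eqP; exact: (sym_uniq symP) sa sa0.
Qed.

Lemma sym_exact_eq a n m f g : sym a n f -> f != 0 -> sym a m g -> g != 0 ->
  n = m.
Proof.
move=> sa f0 sa' g0; apply/eqP; rewrite eq_le.
by rewrite (sym_exact_le sa f0 sa') (sym_exact_le sa' g0 sa).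
Qed.

Lemma sym1 : sym 1 0 1.
Proof. by have := sym_scalar symP 1; rewrite !scale1r rmorph1. Qed.

Lemma symX a n f k : sym a n f -> sym (a ^+ k) (k%:Z * n) (f ^+ k).
Proof.
move=> sa; elim: k => [|k IH]; first by rewrite mul0r !expr0; exact: sym1.
by rewrite !exprS -[k.+1]add1n PoszD mulrDl mul1r; exact: (symM symP).
Qed.

Lemma sym_comm a b n m f g : sym a n f -> sym b m g ->
  exists e, sym (a * b - b * a) (n + m - 1) e.
Proof.
move=> sa sb; apply: (sym_lower symP).
have -> : 0 = f * g - g * f by rewrite mulrC subrr.
apply: (symB symP); first exact: (symM symP).
by rewrite addrC; exact: (symM symP).
Qed.

(** For y in O, lift y to an element of order 0 and let E y be the coefficient
    of its bracket with P in order n - 1: two lifts differ by an element of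
    negative order, so E is a well-defined derivation, and E x is n times the
    coefficient p of P. Write q1 / q2 = u / v with u and v in O. Then
    v Q1 - u Q2 has order less than m, and its bracket with P, which only
    involves the brackets of v and u, has order less than n - 1 + m. So
    u (E v) = v (E u), and u / v is a scalar. *)
Lemma commuting_symbols_proportional P Q1 Q2 n m p q1 q2 :
  sym P n p -> p != 0 -> n != 0 -> GRing.comm P Q1 -> GRing.comm P Q2 ->
  sym Q1 m q1 -> sym Q2 m q2 -> q2 != 0 -> exists c, q1 = phi c%:A * q2.
Proof.
move=> sP p0 n0 PQ1 PQ2 sQ1 sQ2 q20.
have /choice[r rP] := sym_function symP.
have brE a y : sym a 0 (phi y) -> exists e, sym (P * a - a * P) (n - 1) e.
  by move=> sa; have := sym_comm sP sa; rewrite addr0.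
have /choice[E EP] : forall y, exists e, sym (P * r y - r y * P) (n - 1) e.
  by move=> y; exact: brE (rP y).
have EE a y e : sym a 0 (phi y) -> sym (P * a - a * P) (n - 1) e -> E y = e.
  move=> sa se; apply/eqP; rewrite -subr_eq0; apply/eqP.
  have := symB symP (EP y) se.
  have -> : P * r y - r y * P - (P * a - a * P) = P * (r y - a) - (r y - a) * P.
    by rewrite mulrBr mulrBl !opprB addrACA [RHS]addrACA; congr (_ + _);
      rewrite addrC.
  have : sym (r y - a) 0 0 by rewrite -(subrr (phi y)); apply: (symB symP).
  move=> /(sym_lower symP)[f sf] s1; apply: (sym_uniq symP s1).
  have [e' se'] := sym_comm sP sf.
  by apply: (sym_raise symP (f := e')); rewrite sub0r in se'.
have EB : zmod_morphism E.
  move=> y z; apply: (EE (r y - r z)); first by rewrite rmorphB;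
    apply: (symB symP).
  have -> : P * (r y - r z) - (r y - r z) * P = P * r y - r y * P - (P * r z -
    r z * P).
    by rewrite mulrBr mulrBl !opprB addrACA [RHS]addrACA; congr (_ + _);
      rewrite addrC.
  exact: (symB symP).
pose D : {additive O -> L} := HB.pack E (GRing.isZmodMorphism.Build _ _ E EB).
have derD : is_derivation phi D.
  move=> y z; apply: (EE (r y * r z)); first by rewrite rmorphM;
    apply: (symM symP (n := 0) (m := 0)).
  have -> : P * (r y * r z) - r y * r z * P =
      r y * (P * r z - r z * P) + (P * r y - r y * P) * r z.
    by rewrite mulrBr mulrBl !mulrA [RHS]addrC addrA subrK.
  apply: symD; first by have := symM symP (rP y) (EP z); rewrite add0r.
  by have := symM symP (EP y) (rP z); rewrite addr0 mulrC.
have D0 c : D c%:A = 0.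
  apply: (EE c%:A); first exact: (sym_scalar symP).
  by rewrite -scalerAl -scalerAr mul1r mulr1 subrr; exact: (sym0 symP).
have Dx : D x != 0.
  have -> : D x = n%:~R * p.
    apply: (EE h); first exact: (sym_coordinate symP).
    exact: (sym_ad symP).
  by rewrite mulf_neq0 // intr_neq0.
have [u [v [v0 quv]]] := fracL (q1 / q2).
have sX : sym (r v * Q1 - r u * Q2) m 0.
  have -> : 0 = phi v * q1 - phi u * q2.
    by move/eqP: quv; rewrite eqr_div // mulrC => /eqP ->; rewrite subrr.
  by rewrite -[m]add0r; apply: (symB symP); exact: (symM symP).
have [e se] := sym_lower symP sX.
have [e' se'] := sym_comm sP se.
have eD : phi u * D v = phi v * D u.
  have s0 : sym (P * (r v * Q1 - r u * Q2) - (r v * Q1 - r u * Q2) * P)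
    (n - 1 + m) 0.
    apply: (sym_raise symP (f := e')).
    by have -> : n - 1 + m - 1 = n + (m - 1) - 1 by ring.
  have {}s0 : sym ((P * r v - r v * P) * Q1 - (P * r u - r u * P) * Q2)
    (n - 1 + m) 0.
    suff -> : (P * r v - r v * P) * Q1 - (P * r u - r u * P) * Q2 =
      P * (r v * Q1 - r u * Q2) - (r v * Q1 - r u * Q2) * P by [].
    rewrite mulrBr !mulrBl -!mulrA -PQ1 -PQ2 !opprB.
    by rewrite addrACA [RHS]addrACA; congr (_ + _); rewrite addrC.
  have s1 := symB symP (symM symP (EP v) sQ1) (symM symP (EP u) sQ2).
  have e0 := sym_uniq symP s1 s0.
  have : phi v * (D v * q1 - D u * q2) = 0 by rewrite e0 mulr0.
  have -> : phi v * (D v * q1 - D u * q2) = D v * (q1 * phi v) - phi v * D u *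
    q2 by ring.
  move/eqP: quv; rewrite eqr_div // => /eqP ->.
  have -> : D v * (phi u * q2) - phi v * D u * q2 = (phi u * D v - phi v * D u)
    * q2 by ring.
  by move/eqP; rewrite mulf_eq0 (negPf q20) orbF subr_eq0 => /eqP.
have v_neq0 : v != 0 by apply: contra_neq v0 => ->; rewrite rmorph0.
have [c uc] := const_der derD D0 (ex_intro _ x Dx) v_neq0 eD.
exists c; apply: (mulIf (invr_neq0 q20)); rewrite quv uc rmorphM.
by rewrite mulfK // mulfK.
Qed.

(** Let n = k + 1 be the order of P, and e the least positive integer of the
    form v + z n with v the order of some element of the centralizer; such an
    element is taken for Q. For S of order v, let i be the remainder of v + a n
    modulo e, with quotient j. Multiplying S by Q^(j k) changes its order by
    -j w, hence by -j e, modulo n; so i has the same form as e, and is 0. *)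
Lemma exists_degree_generator P (k : nat) p :
  sym P k.+1%:Z p -> p != 0 ->
  exists Q w q, [/\ GRing.comm P Q, sym Q w q, q != 0 &
    forall S v f, GRing.comm P S -> sym S v f -> f != 0 ->
      exists j i l : nat, v + i%:Z * k.+1%:Z = j%:Z * w + l%:Z * k.+1%:Z].
Proof.
move=> sP p0; set n := k.+1%:Z.
pose deg (e : nat) := `[< (0 < e)%N /\ exists S v f (z : int),
  [/\ GRing.comm P S, sym S v f, f != 0 & e%:Z = v + z * n] >].
have ex_deg : exists e, deg e.
  exists k.+1; apply/asboolP; split=> //; exists 1, 0, 1, 1.
  by split; [exact: commr1 | exact: sym1 | exact: oner_neq0 | rewrite add0r
    mul1r].
have [e /asboolP[e_gt0 [Q [w [q [z [PQ sQ q0 De]]]]]] min_e] := ex_minnP ex_deg.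
exists Q, w, q; split=> // S v f PS sS f0.
have [a Da] : exists a r : nat, v + a%:Z * n = r%:Z.
  have le_v : - v <= (absz v)%:Z by rewrite abszE -normrN ler_norm.
  have le_vn : (absz v)%:Z <= (absz v)%:Z * n by rewrite ler_peMr // lez_nat.
  have pos : 0 <= v + (absz v)%:Z * n.
    by have := le_trans le_v le_vn; rewrite -subr_ge0 opprK addrC.
  by exists (absz v), (absz (v + (absz v)%:Z * n)); rewrite (gez0_abs pos).
case: Da => r Dr.
pose j := (r %/ e)%N; pose i := (r %% e)%N.
have Di : i = 0%N.
  apply/eqP; rewrite -leqn0 leqNgt; apply/negP => i_gt0.
  have : (e <= i)%N.
    apply: min_e; apply/asboolP; split=> //.
    exists (S * Q ^+ (j * k)), (v + (j * k)%N%:Z * w), (f * q ^+ (j * k)).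
    exists (a%:Z - j%:Z * z - j%:Z * w); split.
    - by apply: commrM => //; exact: commrX.
    - by apply: (symM symP) => //; exact: symX.
    - by rewrite mulf_neq0 // expf_neq0.
    - have Dre : r%:Z = j%:Z * e%:Z + i%:Z by rewrite {1}(divn_eq r e) PoszD
        PoszM.
      have -> : i%:Z = r%:Z - j%:Z * e%:Z by rewrite Dre addrAC subrr add0r.
      rewrite -Dr De PoszM /n -addn1 PoszD; ring.
  by rewrite leqNgt ltn_mod e_gt0.
pose t : int := a%:Z - j%:Z * z.
exists j, (absz t), (absz (`|t| - t)).
have pos : 0 <= `|t| - t by rewrite subr_ge0 ler_norm.
rewrite (gez0_abs pos) abszE.
have Dre : r%:Z = j%:Z * e%:Z by rewrite {1}(divn_eq r e) -/i Di addn0 PoszM.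
have -> : v = r%:Z - a%:Z * n by rewrite -Dr addrK.
rewrite Dre De /t; ring.
Qed.

(** The order of [S * P ^+ a - T] relative to that of [P ^+ a] goes down by one
    at each step. When this bound is attained, the difference times a power of P
    has the same order as a monomial in Q and P, and subtracting a scalar
    multiple of this monomial lowers it. The clause on [U] stands for the fact
    that [T] is a polynomial in P and Q. *)
Lemma centralizer_approximation P Q S (k : nat) p w q v (N : nat) f :
  sym P k.+1%:Z p -> p != 0 -> GRing.comm P Q -> sym Q w q -> q != 0 ->
  (forall S v f, GRing.comm P S -> sym S v f -> f != 0 ->
      exists j i l : nat, v + i%:Z * k.+1%:Z = j%:Z * w + l%:Z * k.+1%:Z) ->
  GRing.comm P S -> sym S v f ->
  exists (a : nat) T, [/\ GRing.comm P T,
    forall U, GRing.comm P U -> GRing.comm Q U -> GRing.comm U T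
    & exists g, sym (S * P ^+ a - T) (v + a%:Z * k.+1%:Z - N%:Z) g].
Proof.
move=> sP p0 PQ sQ q0 gen PS sS; elim: N => [|N [a [T [PT TU [g sg]]]]].
  exists 0%N, 0; split; [exact: commr0 | by move=> U _ _; exact: commr0 |].
  by exists f; rewrite expr0 mulr1 !subr0.
have PP : GRing.comm P P by [].
have PX (b : nat) : GRing.comm P (S * P ^+ b - T).
  by apply: commrB => //; apply: commrM => //; exact: commrX.
have [g0|g0] := eqVneq g 0.
  exists a, T; split=> //; have [g' sg'] : exists g', sym (S * P ^+ a - T)
    (v + a%:Z * k.+1%:Z - N%:Z - 1) g'.
    by apply: (sym_lower symP); rewrite -g0.
  by exists g'; rewrite -[N.+1]addn1 PoszD opprD addrA.
have [j [i [l Dd]]] := gen _ _ _ (PX a) sg g0.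
have s1 := symM symP sg (symX i sP).
have s2 := symM symP (symX j sQ) (symX l sP); rewrite -Dd in s2.
have PY : GRing.comm P (Q ^+ j * P ^+ l) by apply: commrM; exact: commrX.
have [c gc] : exists c, g * p ^+ i = phi c%:A * (q ^+ j * p ^+ l).
  apply: (commuting_symbols_proportional sP p0 _ _ PY s1 s2) => //.
    by apply: commrM => //; exact: commrX.
  by rewrite mulf_neq0 ?expf_neq0.
have Uc U : GRing.comm U c%:A.
  by rewrite /GRing.comm -scalerAl -scalerAr mul1r mulr1.
exists (a + i)%N, (T * P ^+ i + c%:A * (Q ^+ j * P ^+ l)); split.
- apply: commrD; apply: commrM => //; exact: commrX.
- move=> U PU QU; apply: commrD; apply: commrM => //; first exact: TU.
  + by apply: commrX; apply: commr_sym.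
  + apply: commrM; apply: commrX; exact: commr_sym.
- have s3 := symM symP (sym_scalar symP c) s2; rewrite add0r in s3.
  have {}s3 := symB symP s1 s3; rewrite gc subrr in s3.
  have [g' sg'] := sym_lower symP s3; exists g'.
  have -> : S * P ^+ (a + i) - (T * P ^+ i + c%:A * (Q ^+ j * P ^+ l)) =
    (S * P ^+ a - T) * P ^+ i - c%:A * (Q ^+ j * P ^+ l).
    by rewrite exprD mulrBl opprD addrA mulrA.
  have -> : v + (a + i)%N%:Z * k.+1%:Z - N.+1%:Z = v + a%:Z * k.+1%:Z - N%:Z +
    i%:Z * k.+1%:Z - 1.
    by rewrite PoszD -[N.+1]addn1 PoszD; ring.
  exact: sg'.
Qed.

(** If U commutes with P and Q, then the commutator of S and U times a power of
    P is the commutator of U with an approximation error of S, so its order is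
    as low as desired. This applies first to U = Q, hence to every U that
    commutes with P. *)
Lemma centralizer_commutative_pos P (k : nat) p : sym P k.+1%:Z p -> p != 0 ->
  forall S T, GRing.comm P S -> GRing.comm P T -> GRing.comm S T.
Proof.
move=> sP p0; have [Q [w [q [PQ sQ q0 gen]]]] := exists_degree_generator sP p0.
have key S U : GRing.comm P S -> GRing.comm P U -> GRing.comm Q U ->
    GRing.comm S U.
  move=> PS PU QU; have [->|S0] := eqVneq S 0; first exact/commr_sym/commr0.
  have [->|U0] := eqVneq U 0; first exact: commr0.
  have [v [f [f0 sS]]] := sym_exact symP S0.
  have [u [e [e0 sU]]] := sym_exact symP U0.
  rewrite /GRing.comm; apply/eqP; rewrite -subr_eq0; apply/negP => /negP C0.
  have [d [g [g0 sC]]] := sym_exact symP C0.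
  have bound (N : nat) : d <= v + u - 1 - N%:Z.
    have [a [T [PT TU [g' sX]]]] := centralizer_approximation N sP p0 PQ sQ q0
      gen PS sS.
    have [e' sXU] := sym_comm sX sU.
    have sCP := symM symP sC (symX a sP).
    have CE : (S * U - U * S) * P ^+ a = (S * P ^+ a - T) * U - U * (S * P ^+ a
      - T).
      have UP : U * P ^+ a = P ^+ a * U by apply: commrX; exact: commr_sym.
      have UT : U * T = T * U by exact: TU.
      rewrite !mulrBl mulrBr UT opprB addrA subrK; congr (_ - _).
        by rewrite -!mulrA UP.
      by rewrite mulrA.
    rewrite CE in sCP.
    have := sym_exact_le sCP (mulf_neq0 g0 (expf_neq0 _ p0)) sXU.
    have -> : v + a%:Z * k.+1%:Z - N%:Z + u - 1 = v + u - 1 - N%:Z + a%:Z *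
      k.+1%:Z by ring.
    by rewrite lerD2r.
  have := bound (absz (v + u - 1 - d + 1)); rewrite leNgt => /negP; apply.
  rewrite ltrBlDr -ltrBlDl; apply: (lt_le_trans _ (_ : v + u - 1 - d + 1 <= _)).
    by rewrite ltrDl.
  by rewrite abszE ler_norm.
by move=> S T PS PT; apply: (key S T) => //; apply/commr_sym/(key T Q).
Qed.

Lemma sym_sub_scalar a n f c : sym a n f -> f = phi c%:A -> n = 0 ->
  exists g, sym (a - c%:A) (-1) g.
Proof.
move=> sa Df n0; rewrite n0 in sa; have [g sg] : exists g, sym (a - c%:A)
  (0 - 1) g.
  apply: (sym_lower symP); rewrite -(subrr f) {2}Df.
  by apply: (symB symP) => //; exact: (sym_scalar symP).
by exists g; rewrite sub0r in sg.
Qed.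

Theorem symbol_centralizer_commutative P :
  (forall c, P <> c%:A) ->
  forall S T, GRing.comm P S -> GRing.comm P T -> GRing.comm S T.
Proof.
(* In negative order, pass to the inverse, which has the same centralizer. *)
have nonzero P' n p : sym P' n p -> p != 0 -> n != 0 ->
    forall S T, GRing.comm P' S -> GRing.comm P' T -> GRing.comm S T.
  move=> sP p0 n0 S T PS PT; have [n_gt0|n_le0] := ltP 0 n.
    case: n n_gt0 sP {n0} => [[|k]|k] // _ sP.
    exact: (centralizer_commutative_pos sP p0).
  have n_lt0 : n < 0 by rewrite lt_neqAle n0.
  have [P1 [PP1 P1P]] := sym_unit symP sP p0 n_lt0.
  have P10 : P1 != 0.
    by apply/eqP => e; move/eqP: PP1; rewrite e mulr0 eq_sym oner_eq0.
  have [m [g [g0 sP1]]] := sym_exact symP P10.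
  have := symM symP sP sP1; rewrite PP1 => s1.
  have := sym_exact_eq s1 (mulf_neq0 p0 g0) sym1 (oner_neq0 _) => /eqP.
  rewrite addr_eq0 => /eqP nm.
  have m_gt0 : 0 < m by rewrite -oppr_lt0 -nm.
  have comm1 U : GRing.comm P' U -> GRing.comm P1 U.
    move=> PU; rewrite /GRing.comm -[in RHS](mul1r U) -P1P -!mulrA [P' * (U *
      _)]mulrA.
    by rewrite PU -[U * P' * P1]mulrA PP1 mulr1.
  case: m m_gt0 sP1 {s1 nm} => [[|k]|k] // _ sP1.
  exact: (centralizer_commutative_pos sP1 g0 (comm1 _ PS) (comm1 _ PT)).
move=> nP S T PS PT.
have P0 : P != 0 by apply/eqP => e; apply: (nP 0); rewrite scale0r.
have [n [p [p0 sP]]] := sym_exact symP P0.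
have [n0|n0] := eqVneq n 0; last exact: nonzero sP p0 n0 _ _ PS PT.
have [[c Dp]|np] := pselect (exists c, p = phi c%:A).
  have [g sg] := sym_sub_scalar sP Dp n0.
  have R0 : P - c%:A != 0 by rewrite subr_eq0; apply/eqP; exact: nP.
  have [m [g' [g'0 sg']]] := sym_exact symP R0.
  have m0 : m != 0.
    by apply: contraTneq (sym_exact_le sg' g'0 sg) => ->.
  have Rc U : GRing.comm P U -> GRing.comm (P - c%:A) U.
    move=> PU; apply/commr_sym/commrB; first exact/commr_sym.
    by rewrite /GRing.comm -scalerAl -scalerAr mul1r mulr1.
  exact: nonzero sg' g'0 m0 _ _ (Rc _ PS) (Rc _ PT).
(* Only order 0 occurs in the centralizer; commutators have negative order. *)
have order0 U v f : GRing.comm P U -> sym U v f -> f != 0 -> v = 0.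
  move=> PU sU f0; apply/eqP/negP => /negP v0; apply: np.
  rewrite n0 in sP.
  have [c Dc] := commuting_symbols_proportional sU f0 v0 (commr_sym PU)
    (commr1 U) sP sym1 (oner_neq0 _).
  by exists c; rewrite Dc mulr1.
have [->|S0] := eqVneq S 0; first exact/commr_sym/commr0.
have [->|T0] := eqVneq T 0; first exact: commr0.
have [v [f [f0 sS]]] := sym_exact symP S0.
have [u [g [g0 sT]]] := sym_exact symP T0.
rewrite /GRing.comm; apply/eqP; rewrite -subr_eq0; apply/negP => /negP C0.
have [d [e [e0 sC]]] := sym_exact symP C0.
have PC : GRing.comm P (S * T - T * S) by apply: commrB; apply: commrM.
have [e' sC'] := sym_comm sS sT.
have := sym_exact_le sC e0 sC'.
by rewrite (order0 _ _ _ PC sC e0) (order0 _ _ _ PS sS f0)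
  (order0 _ _ _ PT sT g0).
Qed.

End SymbolMap.

(** * Orders in the division ring of fractions *)

Section FractionSymbols.
Variables (K : closedFieldType) (O : comAlgType K) (L : fieldType)
  (phi : {rmorphism O -> L}).
Variables (A : algType K) (x : O) (h : A) (sym : A -> int -> L -> Prop).
Hypothesis symP : is_symbol phi x h sym.
Variables (G : unitAlgType K) (j : {lrmorphism A -> G}).
Hypothesis fracG : is_division_ring_of_fractions j.

(** The order of [q] is that of [a] minus that of [s]; as [g] is nonzero, the
    order of [s] is exactly [k]. *)
Definition frac_sym (q : G) (n : int) (f : L) : Prop :=
  exists a s k F g, [/\ sym a (n + k) F, sym s k g, g != 0,
    q * j s = j a & f = F / g].

Lemma nonzero_of_sym a n f : sym a n f -> f != 0 -> a != 0.
Proof.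
move=> sa; apply: contra_neq => a0; rewrite a0 in sa.
exact: (sym_uniq symP) sa (sym0 symP n).
Qed.

Lemma sym_quotient s c k g N H : sym s k g -> g != 0 -> sym (s * c) N H ->
  sym c (N - k) (H / g).
Proof.
move=> ss g0 sc; have [c0|c0] := eqVneq c 0.
  rewrite c0 mulr0 in sc; rewrite (sym_uniq symP sc (sym0 symP N)) mul0r c0.
  exact: (sym0 symP).
have [i [u [u0 su]]] := sym_exact symP c0.
have s1 := symM symP ss su; have gu0 : g * u != 0 by rewrite mulf_neq0.
have := sym_exact_le symP s1 gu0 sc; rewrite le_eqVlt => /predU1P[DN|lt_N].
  rewrite -DN in sc *; rewrite -(sym_uniq symP s1 sc) [g * u]mulrC mulfK //.
  by rewrite addrAC subrr add0r.
have -> : H / g = 0.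
  by rewrite (sym_uniq symP sc (sym_lt symP s1 lt_N)) mul0r.
by apply: (sym_lt symP su); rewrite ltrBrDr addrC.
Qed.

Lemma unitG (q : G) : q != 0 -> q \is a GRing.unit.
Proof. by have [fldG _ _ _] := fracG; exact: fldG. Qed.

Lemma j_neq0 (a : A) : a != 0 -> j a != 0.
Proof. by have [_ injj _ _] := fracG; exact: rmorph_inj_neq0. Qed.

(** Both forms of a fraction exist: rewrite s^-1 t as c d^-1. *)
Lemma right_ore (s t : A) : s != 0 -> exists c d, d != 0 /\ t * d = s * c.
Proof.
move=> s0; have [_ injj _ fr] := fracG.
have [c [d [d0 e]]] := fr ((j s)^-1 * j t); exists c, d; split=> //.
have us := unitG (j_neq0 s0); have ud := unitG (j_neq0 d0).
have := congr1 (fun z => j s * z * j d) e.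
by rewrite mulVKr // mulrA mulrVK // => e'; apply: injj; rewrite !rmorphM.
Qed.

Lemma frac_sym_rescale q n f a s c k i F g u :
  sym a (n + k) F -> sym s k g -> q * j s = j a -> f = F / g -> g != 0 ->
  sym c i u -> u != 0 ->
  [/\ sym (a * c) (n + (k + i)) (F * u), sym (s * c) (k + i) (g * u),
      g * u != 0, q * j (s * c) = j (a * c) & f = F * u / (g * u)].
Proof.
move=> sa ss qs -> g0 sc u0; split.
- by rewrite addrA; exact: (symM symP).
- exact: (symM symP).
- exact: mulf_neq0.
- by rewrite !rmorphM mulrA qs.
- by rewrite -mulf_div divff // mulr1.
Qed.

(** A common right multiple of the two denominators serves for both. *)
Lemma frac_sym_common q q' n n' f f' : frac_sym q n f -> frac_sym q' n' f' ->
  exists a a' s k g F F', [/\ sym s k g, g != 0,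
    [/\ sym a (n + k) F, q * j s = j a & f = F / g] &
    [/\ sym a' (n' + k) F', q' * j s = j a' & f' = F' / g]].
Proof.
move=> [a [s [k [F [g [sa ss g0 qs Df]]]]]] [a' [s' [k' [F' [g' [sa' ss' g'0
  qs' Df']]]]]].
have [c [d [d0 e]]] := right_ore s' (nonzero_of_sym ss g0).
have [l [w [w0 sd]]] := sym_exact symP d0.
have c0 : c != 0.
  have : s' * d != 0 by exact: nonzero_of_sym (symM symP ss' sd)
    (mulf_neq0 g'0 w0).
  by apply: contra_neq => c0; rewrite e c0 mulr0.
have [i [u [u0 sc]]] := sym_exact symP c0.
have [sac ssc gu0 qsc Df1] := frac_sym_rescale sa ss qs Df g0 sc u0.
have [sad ssd g'w0 qsd Df1'] := frac_sym_rescale sa' ss' qs' Df' g'0 sd w0.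
rewrite e in ssd qsd.
have Dk := sym_exact_eq symP ssc gu0 ssd g'w0.
have Dg : g * u = g' * w by apply: (sym_uniq symP ssc); rewrite Dk.
exists (a * c), (a' * d), (s * c), (k + i), (g * u), (F * u), (F' * w).
by split=> //; rewrite Dk Dg.
Qed.

Lemma frac_sym_embed a n f : sym a n f -> frac_sym (j a) n f.
Proof.
move=> sa; exists a, 1, 0, f, 1; rewrite addr0 rmorph1 mulr1 divr1.
by split=> //; [exact: (sym1 symP) | exact: oner_neq0].
Qed.

Lemma frac_symM a b n m f g : frac_sym a n f -> frac_sym b m g ->
  frac_sym (a * b) (n + m) (f * g).
Proof.
move=> [a1 [s [k [F [u [sa ss u0 qs ->]]]]]] [b1 [t [l [H [v [sb st v0 qt
  ->]]]]]].
have [c [d [d0 e]]] := right_ore b1 (nonzero_of_sym ss u0).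
have [i [w [w0 sd]]] := sym_exact symP d0.
have sbd := symM symP sb sd; rewrite e in sbd.
have sc := sym_quotient ss u0 sbd.
exists (a1 * c), (t * d), (l + i), (F * (H * w / u)), (v * w); split.
- have -> : n + m + (l + i) = n + k + (m + l + i - k) by ring.
  exact: (symM symP).
- exact: (symM symP).
- exact: mulf_neq0.
- have e' : j b1 * j d = j s * j c by rewrite -!rmorphM e.
  by rewrite !rmorphM mulrA -[a * b * _]mulrA qt -mulrA e' mulrA qs.
- by field; rewrite u0 v0 w0.
Qed.

Lemma frac_symV s k g : sym s k g -> g != 0 -> frac_sym (j s)^-1 (- k) g^-1.
Proof.
move=> ss g0; exists 1, s, k, 1, g; split=> //; last by rewrite mul1r.
  by rewrite addNr; exact: (sym1 symP).
by rewrite mulVr ?rmorph1 // unitG // j_neq0 // (nonzero_of_sym ss).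
Qed.

Lemma frac_symB a b n f g : frac_sym a n f -> frac_sym b n g ->
  frac_sym (a - b) n (f - g).
Proof.
move=> sa sb; have [a1 [b1 [s [k [u [F [H [ss u0 [sa1 qs ->] [sb1 qt
  ->]]]]]]]]] :=
  frac_sym_common sa sb.
exists (a1 - b1), s, k, (F - H), u; split=> //; last by rewrite mulrBl.
  exact: (symB symP).
by rewrite mulrBl rmorphB qs qt.
Qed.

Lemma frac_symP : is_symbol phi x (j h) frac_sym.
Proof.
have [fldG injj fl fr] := fracG.
split.
- by move=> n; rewrite -(rmorph0 j); apply: frac_sym_embed; exact: (sym0 symP).
- move=> q n f f' sf sf'.
  have [a [a' [s [k [g [F [F' [ss g0 [sa qs ->] [sa' qs' ->]]]]]]]]] :=
    frac_sym_common sf sf'.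
  have aa' : a = a' by apply: injj; rewrite -qs.
  by rewrite -aa' in sa'; rewrite (sym_uniq symP sa sa').
- exact: frac_symB.
- exact: frac_symM.
- move=> q q0; have [a [s [s0 Dq]]] := fr q.
  have a0 : a != 0 by apply: contra_neq q0 => a0; rewrite Dq a0 rmorph0 mul0r.
  have [n [f [f0 sa]]] := sym_exact symP a0; have [k [g [g0 ss]]] :=
    sym_exact symP s0.
  exists (n - k), (f / g); split; first by rewrite mulf_neq0 // invr_eq0.
  rewrite Dq; apply: frac_symM; [exact: frac_sym_embed | exact: frac_symV].
- move=> q n [a [s [k [F [g [sa ss g0 qs Df]]]]]].
  have F0 : F = 0.
    by move/eqP: Df; rewrite eq_sym mulf_eq0 invr_eq0 (negPf g0) orbF => /eqP.
  rewrite F0 in sa; have [F' sa'] := sym_lower symP sa.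
  exists (F' / g), a, s, k, F', g; split=> //.
  by have -> : n - 1 + k = n + k - 1 by ring.
- move=> q n f [a [s [k [F [g [sa ss g0 qs Df]]]]]].
  exists a, s, k, 0, g; split=> //; last by rewrite mul0r.
  by apply: (sym_raise symP (f := F)); have -> : n + k - 1 = n - 1 + k by ring.
- by move=> c; rewrite -(rmorph_alg j); apply: frac_sym_embed;
    exact: (sym_scalar symP).
- by move=> y; have [a sa] := sym_function symP y; exists (j a);
    exact: frac_sym_embed.
- exact: frac_sym_embed (sym_coordinate symP).
- move=> q n f sq; have [a [s [k [F [g [sa ss g0 qs Df]]]]]] := sq.
  have s0 : s != 0 by exact: nonzero_of_sym ss g0.
  have us := unitG (j_neq0 s0).
  have e : q * j h - j h * q = (j (a * h - h * a) - q * j (s * h - h * s)) * (j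
    s)^-1.
    apply: (mulIr us); rewrite mulrVK //.
    have -> : j (a * h - h * a) = q * j s * j h - j h * (q * j s).
      by rewrite qs rmorphB !rmorphM.
    have -> : j (s * h - h * s) = j s * j h - j h * j s
      by rewrite rmorphB !rmorphM.
    by rewrite mulrBl mulrBr !mulrA opprB [RHS]addrC addrA subrK.
  have s1 := frac_sym_embed (sym_ad symP sa).
  have s2 := frac_symM sq (frac_sym_embed (sym_ad symP ss)).
  have -> : n - 1 = n + k - 1 - k by ring.
  rewrite e; have -> : n%:~R * f = ((n + k)%:~R * F - f * (k%:~R * g)) * g^-1.
    by rewrite Df intrD; field.
  apply: frac_symM; last exact: frac_symV.
  by apply: frac_symB => //; rewrite -addrA.
- move=> q n f sq f0 _; have q0 : q != 0.
    apply: contra_neq f0 => q0; rewrite q0 in sq.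
    have := frac_sym_common sq (frac_sym_embed (sym0 symP n)).
    move=> [a [a' [s [k [g [F [F' [ss g0 [sa qs ->] [sa' qs' _]]]]]]]]].
    have a0 : a = 0 by apply: injj; rewrite -qs mul0r rmorph0.
    by rewrite a0 in sa; rewrite (sym_uniq symP sa (sym0 symP _)) mul0r.
  by exists q^-1; rewrite mulrV ?mulVr ?unitG.
Qed.

End FractionSymbols.

(** * Orders of differential operators *)

Section BracketIteration.
Variables (A : nzRingType) (h : A).

Definition bracket (u : A) : A := u * h - h * u.

Lemma bracketB u v : bracket (u - v) = bracket u - bracket v.
Proof. by rewrite /bracket mulrBl mulrBr !opprB addrACA [RHS]addrACA;
  congr (_ + _); rewrite addrC. Qed.

Lemma bracketM u v : bracket (u * v) = bracket u * v + u * bracket v.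
Proof. by rewrite /bracket mulrBr mulrBl !mulrA [RHS]addrC addrA subrK. Qed.

Lemma iter_bracketB n u v :
  iter n bracket (u - v) = iter n bracket u - iter n bracket v.
Proof. by elim: n => //= n ->; rewrite bracketB. Qed.

Lemma iter_bracket0 n : iter n bracket 0 = 0.
Proof. by elim: n => //= n ->; rewrite /bracket mul0r mulr0 subrr. Qed.

Lemma iter_bracketD n u v :
  iter n bracket (u + v) = iter n bracket u + iter n bracket v.
Proof.
rewrite -{1}[v]opprK -[- v]sub0r !iter_bracketB iter_bracket0 sub0r opprK //.
Qed.

(** Of the Leibniz expansion only the term of bidegree (m, n) survives; its
    binomial coefficient is accumulated by Pascal's rule. *)
Lemma iter_bracketM m n u v :
  iter m.+1 bracket u = 0 -> iter n.+1 bracket v = 0 ->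
  iter (m + n) bracket (u * v)
    = iter m bracket u * iter n bracket v *+ 'C(m + n, m)
  /\ iter (m + n).+1 bracket (u * v) = 0.
Proof.
move Dk: (m + n)%N => k; elim: k m n u v Dk => [|k IH] m n u v.
  case: m n => [|m] [|n] //= _ u0 v0; split=> //.
  by rewrite bracketM u0 v0 mul0r mulr0 addr0.
rewrite [iter k.+2 _ _]iterSr [iter k.+1 _ _]iterSr bracketM !iter_bracketD.
move=> Dk u0 v0.
have left_part : iter k bracket (bracket u * v)
      = iter m bracket u * iter n bracket v
          *+ (if m is m'.+1 then 'C(k, m') else 0)
    /\ iter k.+1 bracket (bracket u * v) = 0.
  case: m Dk u0 => [|m'] Dk u0.
    by rewrite [bracket u]u0 mul0r !iter_bracket0 mulr0n.
  by have := IH m' n (bracket u) v; rewrite -!iterSr; apply=> //; move: Dk;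
    rewrite addSn => -[].
have right_part : iter k bracket (u * bracket v)
      = iter m bracket u * iter n bracket v
          *+ (if n is n'.+1 then 'C(k, m) else 0)
    /\ iter k.+1 bracket (u * bracket v) = 0.
  case: n Dk v0 {left_part} => [|n'] Dk v0.
    by rewrite [bracket v]v0 mulr0 !iter_bracket0 mulr0n.
  by have := IH m n' u (bracket v); rewrite -!iterSr; apply=> //; move: Dk;
    rewrite addnS => -[].
case: left_part => -> ->; case: right_part => -> ->; rewrite addr0; split=> //.
rewrite -mulrnDr; congr (_ *+ _).
case: m n Dk {u0 v0} => [|m'] [|n'] //; rewrite ?addSn ?addnS ?addn0 ?add0n.
- by rewrite !bin0.
- by case=> ->; rewrite !binn.
- by move=> _; rewrite binS addnC.
Qed.

End BracketIteration.

Section DiffopSymbols.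
Variables (K : closedFieldType) (charK0 : [pchar K] =i pred0)
  (O : comAlgType K).
Hypotheses (domO : GRing.integral_domain_axiom O) (fgO : fin_gen_algebra O).
Hypothesis dimO : has_krull_dim O 1%N.
Variables (L : fieldType) (phi : {rmorphism O -> L}).
Hypothesis phi_inj : injective phi.
Hypothesis fracL : forall z, exists a b, phi b != 0 /\ z = phi a / phi b.
Variable x : O.
Hypothesis nx : forall c, x <> c%:A.

Implicit Types u v : diffop O.

Lemma is_diffop_lmul (r : O) : is_diffop (fun y => r * y).
Proof.
split; first exact: linear_lmul.
by exists 0%N => s y; rewrite /dcomm mulrCA subrr.
Qed.

Definition lmul (r : O) : diffop O := DiffOp (is_diffop_lmul r).

Lemma lmul0 : lmul 0 = 0.
Proof. by apply: diffop_ext => y /=; rewrite mul0r. Qed.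

Local Notation ad := (bracket (lmul x)).

Lemma linear0B (u : O -> O) : linear u -> u 0 = 0 /\ {morph u : y z / y - z}.
Proof.
move=> lu; have uB y z : u (y - z) = u y - u z.
  by rewrite [y - z]addrC -scaleN1r lu scaleN1r [RHS]addrC.
by split=> //; rewrite -[X in u X](subrr 0) uB subrr.
Qed.

(** Evaluating the commutator of u and r at 1 gives a derivation in r. It kills
    x; were it nonzero, x would be a scalar. *)
Lemma order1_commuting_with_coordinate (u : O -> O) : linear u ->
  (forall r, diffop_order 0 (dcomm u r)) -> (forall y, dcomm u x y = 0) ->
  diffop_order 0 u.
Proof.
move=> lu ou ux r y.
have oE s z : dcomm u s z = z * dcomm u s 1.
  by have /eqP := ou s z 1; rewrite [dcomm _ _ _]/dcomm subr_eq0 mulr1 => /eqP.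
have [u0 uB] := linear0B lu.
pose e s := phi (dcomm u s 1).
have eB : zmod_morphism e.
  move=> s t; rewrite /e -rmorphB /dcomm !mulr1 uB mulrBl; congr (phi _).
  ring.
pose E : {additive O -> L} := HB.pack e (GRing.isZmodMorphism.Build _ _ e eB).
have derE : is_derivation phi E.
  move=> s t; rewrite -!rmorphM -rmorphD; congr (phi _).
  have -> : dcomm u (s * t) 1 = dcomm u s t + s * dcomm u t 1.
    by rewrite /dcomm !mulr1; ring.
  by rewrite oE addrC.
have E0 c : E c%:A = 0.
  rewrite -(rmorph0 phi); congr (phi _); rewrite /dcomm mulr1.
  have := lu c 1 0; rewrite u0 !addr0 => ->.
  by rewrite -scalerAl mul1r subrr.
have Ex : E x = 0 by rewrite -(rmorph0 phi); congr (phi _); exact: ux.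
suff Er : E r = 0.
  rewrite oE; have -> : dcomm u r 1 = 0 by apply: phi_inj; rewrite rmorph0.
  by rewrite mulr0.
apply/eqP/negP => /negP Er.
have [|c xc] := constants_of_derivation charK0 domO fgO dimO phi_inj fracL (a
  := x) (b := 1)
  derE E0 (ex_intro _ r Er) (oner_neq0 _).
  by rewrite Ex (derivation1 derE) !mulr0.
by apply: (nx (c := c)); rewrite xc mulr1.
Qed.

Lemma dcommC (u : O -> O) r s : linear u -> dcomm (dcomm u r) s = dcomm (dcomm
  u s) r.
Proof.
move=> lu; apply/funext => y; rewrite /dcomm.
by rewrite [s * (r * y)]mulrCA; ring.
Qed.

(** By induction on the order: the commutator of u and r also commutes with x,
    so it has order 0 and u has order at most 1. *)
Lemma commuting_with_coordinate n (u : O -> O) : linear u -> diffop_order n u ->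
  (forall y, dcomm u x y = 0) -> diffop_order 0 u.
Proof.
elim: n u => [//|n IH] u lu ou ux; apply: order1_commuting_with_coordinate =>
  // r.
apply: IH; [exact: linear_dcomm | exact: ou |].
move=> y; rewrite dcommC // (funext ux : dcomm u x = fun=> 0).
by rewrite /dcomm mulr0 subr0.
Qed.

Lemma bracket_eq0_lmul u : ad u = 0 -> u = lmul (u 1).
Proof.
move=> ux; have [lu [n ou]] := diffopP u; apply: diffop_ext => y /=.
have /eqP := commuting_with_coordinate lu ou (fun y =>
  congr1 (fun v : diffop O => v y) ux) y 1.
by rewrite /dcomm mulr1 subr_eq0 mulrC => /eqP.
Qed.

Lemma diffop_bracket_nilpotent u : exists n, iter n ad u = 0.
Proof.
have [_ [n ou]] := diffopP u; exists n.+1; elim: n u ou => [|n IH] u ou.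
  by apply: diffop_ext => y; exact: ou.
by rewrite iterSr; apply: IH => /=; apply: ou.
Qed.

(** The m-fold bracket of an operator of order at most m commutes with x, so it
    is the multiplication by its value at 1, which is m! times the coefficient
    in order m. *)
Definition diffop_sym u (n : int) (f : L) : Prop :=
  if n is Posz m then iter m.+1 ad u = 0 /\ f * m`!%:R = phi (iter m ad u 1)
  else u = 0 /\ f = 0.

Let charL0 := charL0 charK0 phi.

Lemma fact_neq0 m : m`!%:R != 0 :> L.
Proof. by rewrite (pcharf0P L).1 // -lt0n fact_gt0. Qed.

Lemma diffop_sym0 n : diffop_sym 0 n 0.
Proof. by case: n => n; split=> //; rewrite iter_bracket0 // mul0r rmorph0. Qed.

Lemma diffop_symM u v n m f g : diffop_sym u n f -> diffop_sym v m g ->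
  diffop_sym (u * v) (n + m) (f * g).
Proof.
case: n => [n|n]; last by move=> [-> ->] _; rewrite !mul0r; exact: diffop_sym0.
case: m => [m|m]; last by move=> _ [-> ->]; rewrite !mulr0; exact: diffop_sym0.
move=> [u0 Df] [v0 Dg]; have [e e0] := iter_bracketM u0 v0; split=> //.
rewrite e [iter n _ u]bracket_eq0_lmul // [iter m _ v]bracket_eq0_lmul //.
set a := iter n _ u 1; set b := iter m _ v 1.
have -> : (lmul a * lmul b *+ 'C(n + m, n)) 1 = (a * b) *+ 'C(n + m, n).
  elim: 'C(n + m, n) => [|k IH]; first by rewrite !mulr0n.
  by rewrite !mulrS -IH /= mulr1.
rewrite rmorphMn rmorphM /= -Df -Dg -(bin_fact (leq_addr m n)) addKn.
by rewrite -mulr_natr !natrM; ring.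
Qed.

Lemma diffop_symP : is_symbol phi x (lmul x) diffop_sym.
Proof.
split.
- exact: diffop_sym0.
- move=> u [n|n] f g; last by case=> _ -> [_ ->].
  by case=> _ Df [_ Dg]; apply: (mulIf (fact_neq0 n)); rewrite Df.
- move=> u v [n|n] f g; last by case=> -> -> [-> ->] /=; rewrite !subrr.
  move=> [u0 Df] [v0 Dg]; split; first by rewrite iter_bracketB u0 v0 subrr.
  by rewrite iter_bracketB mulrBl Df Dg -rmorphB.
- exact: diffop_symM.
- move=> u u0; have ex : exists n, iter n ad u == 0.
    by have [n e] := diffop_bracket_nilpotent u; exists n; apply/eqP.
  case: (ex_minnP ex) => -[|m] /eqP Dm min_m; first by move: u0;
    rewrite [u]Dm eqxx.
  have nm : iter m ad u != 0.
    by apply/negP => /min_m; rewrite ltnn.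
  exists m, (phi (iter m ad u 1) / m`!%:R); split; last first.
    by split=> //; rewrite divfK // fact_neq0.
  rewrite mulf_neq0 ?invr_eq0 ?fact_neq0 // rmorph_inj_neq0 //.
  apply: contra_neq nm => e; by rewrite [LHS]bracket_eq0_lmul // e lmul0.
- move=> u [[|n]|n]; last first.
  + by case=> u0 _; exists 0; have -> : Negz n - 1 = Negz n.+1
      by rewrite !NegzE -opprD -PoszD addn1.
  + have -> : n.+1%:Z - 1 = n by rewrite -addn1 PoszD addrK.
    move=> [u0]; rewrite mul0r => Df.
    exists (phi (iter n ad u 1) / n`!%:R); split;
      last by rewrite divfK // fact_neq0.
    have e := phi_inj (etrans (esym Df) (esym (rmorph0 phi))).
    by rewrite [LHS]bracket_eq0_lmul // e lmul0.
  + rewrite /= mul0r => -[u0 Df]; exists 0; split=> //.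
    have e := phi_inj (etrans (esym Df) (esym (rmorph0 phi))).
    by rewrite [LHS]bracket_eq0_lmul // e lmul0.
- move=> u [[|n]|n] f; last by move=> [-> _]; exact: diffop_sym0.
    by move=> [-> _]; exact: diffop_sym0.
  have -> : n.+1%:Z - 1 = n by rewrite -addn1 PoszD addrK.
  move=> [u0 _]; split; last by rewrite u0 mul0r rmorph0.
  by rewrite iterS u0; exact: (iter_bracket0 _ 1).
- move=> c; split; first by rewrite /= /bracket -scalerAl -scalerAr mul1r mulr1
    subrr.
  by rewrite mulr1.
- move=> y; exists (lmul y); split; last by rewrite /= !mulr1.
  by apply: diffop_ext => z /=; rewrite mulrCA subrr.
- split; last by rewrite /= !mulr1.
  by rewrite /= /bracket subrr.
- move=> u [[|n]|n] f; rewrite -/(ad u).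
  + by move=> [/= -> _]; rewrite mul0r.
  + have -> : n.+1%:Z - 1 = n by rewrite -addn1 PoszD addrK.
    move=> [u0 Df]; split; first by rewrite -iterSr.
    by rewrite -iterSr -Df factS natrM -pmulrn; ring.
  + move=> [-> ->]; have -> : Negz n - 1 = Negz n.+1
      by rewrite !NegzE -opprD -PoszD addn1.
    by rewrite /= mulr0 /bracket mul0r mulr0 subrr.
- by move=> u [n|n] f // [_ ->]; rewrite eqxx.
Qed.

End DiffopSymbols.


Theorem corollary7p2 (K : closedFieldType) (charK0 : [pchar K] =i pred0)
    (O : comAlgType K)
    (domO : GRing.integral_domain_axiom O)
    (fgO : fin_gen_algebra O)
    (regO : regular O)
    (dimO : has_krull_dim O 1%N) :
  commutative_centralizer_condition (diffop O) /\
  forall (Gamma : unitAlgType K) (j : {lrmorphism diffop O -> Gamma}),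
    is_division_ring_of_fractions j ->
    commutative_centralizer_condition Gamma.
Proof.
have [L [phi [phi_inj fracL]]] := fraction_field domO.
have [x nx] := exists_nonscalar dimO.
have symD := diffop_symP charK0 domO fgO dimO phi_inj fracL nx.
have charL := charL0 charK0 phi.
have constE := constants_of_derivation charK0 domO fgO dimO phi_inj fracL.
have centD (A : algType K) (h : A) (sym : A -> int -> L -> Prop) :
    is_symbol phi x h sym -> ~ commutative (@GRing.mul A) ->
    commutative_centralizer_condition A.
  move=> symA ncA; split=> // a na; apply: (symbol_centralizer_commutative
    charL fracL constE symA) => c ac.
  by apply: na => b; rewrite ac /GRing.comm -scalerAl -scalerAr mul1r mulr1.
have ncD : ~ commutative (@GRing.mul (diffop O)).
  have [E [derE E0 [y Ey]]] := exists_derivation charK0 domO fgO dimO phi_inj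
    fracL.
  have dE : is_diffop E.
    split.
      by move=> c u v; rewrite raddfD /= -mulr_algl derE E0 mulr0 addr0
        mulr_algl.
    by exists 1%N => r s z; rewrite /dcomm /= !derE /=; ring.
  move=> cD; have := congr1 (fun u : diffop O => u 1) (cD (DiffOp dE) (lmul y)).
  rewrite /= mulr1 (derivation1 derE) mulr0 => e.
  by rewrite e eqxx in Ey.
split; first exact: centD symD ncD.
move=> Gamma j fracG; apply: centD (frac_symP symD fracG) _ => cG.
have [_ injj _ _] := fracG.
by apply: ncD => a b; apply: injj; rewrite !rmorphM; exact: cG.
Qed.
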